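(* Let $\lambda$ be a real number with $0.2\le\lambda\le2.9$. Then for positive integers $N$ such that $\lambda N^2$ is also a positive integer, \[ p_N(\lambda N^2)=\left(\sum_{k=1}^{100}W_k(N,\lambda N^2)\right)\bigl(1+O(e^{-0.1N})\bigr) \] as $N\to\infty$, where the implied constant is absolute.
   Context: $p_N(n)$ denotes the number of partitions of the integer $n$ into at most $N$ parts. For integers $k,N\ge 1$ and $n\in\mathbb Z$, the $k$-th Sylvester wave is \[ W_k(N,n):=\operatorname{Res}_{z=0}\sum_{\rho}\frac{\rho^n e^{nz}}{(1-\rho^{-1}e^{-z})(1-\rho^{-2}e^{-2z})\cdots(1-\rho^{-N}e^{-Nz})}, \] the sum over all primitive $k$-th roots of unity $\rho$, $\operatorname{Res}_{z=0}$ meaning the coefficient of $1/z$ in the Laurent expansion at $0$. *)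

(* Defs.v *)
From mathcomp Require Import all_boot all_order all_algebra.
From mathcomp Require Import all_classical all_reals all_analysis.
From mathcomp Require Import complex.

Set Implicit Arguments.
Unset Strict Implicit.
Unset Printing Implicit Defensive.

Import Order.TTheory GRing.Theory Num.Theory.
Import numFieldNormedType.Exports.
Local Open Scope classical_set_scope.
Local Open Scope complex_scope.
Local Open Scope ring_scope.

(* Partitions of n into at most N parts, as the nonincreasing sequences of at
   most N positive integers with sum n (no part exceeds n, whence 'I_n.+1). *)
Definition partitions (N n : nat) : {set {bseq N of 'I_n.+1}} :=
  [set s : {bseq N of 'I_n.+1} |
    let parts := [seq nat_of_ord i | i <- s] in
    [&& sorted geq parts, all (leq 1) parts & sumn parts == n]]%SET.

Definition npartitions (N n : nat) : nat := #|partitions N n|.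

(* [a] is the family of coefficients of a Laurent expansion of f at 0, with
   finite principal part: f z = \sum_(j >= -m) a_j z^j on a punctured
   neighbourhood of 0.  The field is abstract so that the topology of a
   numFieldType is the one used when C is instantiated with R[i]. *)
Definition laurent_expansion0 (C : numFieldType) (f : C -> C) (a : int -> C) :=
  exists m : nat,
    (forall j : int, j < - m%:Z -> a j = 0) /\
    \forall z \near (0 : C)^',
      series (fun i : nat => a (i%:Z - m%:Z) * z ^ (i%:Z - m%:Z)) @ \oo --> f z.

(* The value is 0 by convention when f has no Laurent expansion as above. *)
Definition residue0 (C : numFieldType) (f : C -> C) : C :=
  xget 0 [set r : C | exists2 a : int -> C, laurent_expansion0 f a & r = a (- 1)].

Definition cexp (R : realType) (z : R[i]) : R[i] :=
  (expR (complex.Re z) * cos (complex.Im z)) +i*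
  (expR (complex.Re z) * sin (complex.Im z)).

Definition sylvester_wave (R : realType) (k N : nat) (n : int) : R[i] :=
  residue0 (fun z : R[i] =>
    \sum_(rho \in [set rho : R[i] | k.-primitive_root rho])
      (rho ^ n * cexp (n%:~R * z)
       / \prod_(1 <= j < N.+1) (1 - rho ^- j * cexp (- (j%:R * z))))).

(* Main.v *)
Require Import Defs.
From mathcomp Require Import all_boot all_order all_algebra.
From mathcomp Require Import all_classical all_reals all_analysis.
From mathcomp Require Import complex.
From mathcomp Require Import zify ring lra.

(** The function x^(n-1) / prod_(j<=N) (1 - x^-j) has poles at the roots of
    unity of order at most N.  Its residues there make up the waves W_1, ...,
    W_N, and their sum is p_N(n): both satisfy
    p_N(n) = p_(N-1)(n) + p_N(n-N), and the initial values are an instance of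
    the residue theorem for x^a / prod_i (x - q_i).  The latter is proved
    algebraically: partial fractions separate two distinct q_i, and if all q_i
    coincide the substitution x = q e^z leads to a formal derivative.

    For k > 100 each summand of W_k is bounded through the weighted l^1 norm
    sum |a_i| r^i of its Laurent coefficients at r = 1/(100 k N).  That norm is
    submultiplicative and controls inverses, so the summand is bounded factor
    by factor.  The factors with k not dividing j multiply to at least about
    2^-k, because a full period of |1 - rho^j| has product k; the others cost
    at most (200 k)^(N/k) e^(N/k), or a constant when N < 2k.  So the tail is
    O(N^2 e^(0.73 N)), whereas p_N(n) >= p_(N/2)(n) >= n^(m)/(m! (m+1)!), with
    m = N/2 - 1, is of order at least e^(0.875 N) up to a power of N. *)

Set Implicit Arguments.
Unset Strict Implicit.
Unset Printing Implicit Defensive.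
Import Order.TTheory GRing.Theory Num.Theory.
Import numFieldNormedType.Exports.
Local Open Scope complex_scope.
Local Open Scope ring_scope.

(** The residue is picked by [xget], so nothing can be computed before expansions are shown to be
    unique; [lexp] serves both that purpose and the estimates. A coefficient is bounded by the norm
    over r^i as in Cauchy's estimate, with finite sums in place of contour integrals. The radius is
    dictated by |1 - rho^j| >= 1/k for k not dividing j: at r = 1/(100 k N) such a factor deviates
    from its constant term by at most 1/50 of it, so inverting it costs only 50/49.

    The exponent 0.73 is governed by N/2 < k <= N, where 2^k alone may reach e^(0.7 N), as log 2 <
    7/10. For k <= N/2 this exponent halves, which leaves room for (200 k)^(N/k), at most e^(20
    N/101) once k > 100.

    Keeping all N parts in the lower bound for p_N(n) would give only about (0.2 e^2)^N = e^(0.39 N)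
    at n = 0.2 N^2. With t N parts the exponent is t (2 + log(0.2/t^2)), largest near t = 0.45; t =
    1/2 gives 0.888, of which 7/8 is kept. What remains, 7/8 - 73/100 - 1/10 = 45/1000, absorbs the
    powers of N. *)

(** * A real-valued modulus on the complex numbers *)

Section ComplexModulus.
Variable R : realType.
Local Notation C := (R[i]).

Definition modc (z : C) : R := Normc.normc z.

Lemma norm_modc (z : C) : `|z| = ((modc z)%:C)%C.
Proof. by case: z. Qed.
Lemma modc_ge0 z : 0 <= modc z.
Proof. by case: z => a b; exact: sqrtr_ge0. Qed.
Lemma modc0 : modc 0 = 0. Proof. exact: Normc.normc0. Qed.
Lemma modc1 : modc 1 = 1. Proof. exact: Normc.normc1. Qed.
Lemma modcM x y : modc (x * y) = modc x * modc y. Proof. exact: Normc.normcM. Qed.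
Lemma modcV x : modc x^-1 = (modc x)^-1. Proof. exact: Normc.normcV. Qed.
Lemma modcN x : modc (- x) = modc x. Proof. by exact: (@normcN R x). Qed.
Lemma modcD x y : modc (x + y) <= modc x + modc y.
Proof. exact: (@le_normcD R x y). Qed.
Lemma modcB x y : modc (x - y) <= modc x + modc y.
Proof. by rewrite -(modcN y) modcD. Qed.
Lemma modc_eq0 x : (modc x == 0) = (x == 0).
Proof.
apply/eqP/eqP => [/Normc.eq0_normc //|->]; exact: modc0.
Qed.
Lemma modc_gt0 x : (0 < modc x) = (x != 0).
Proof. by rewrite lt_def modc_ge0 andbT modc_eq0. Qed.
Lemma modcX x n : modc (x ^+ n) = modc x ^+ n.
Proof. by elim: n => [|n IH]; rewrite ?expr0 ?modc1 // !exprS modcM IH. Qed.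
Lemma modc_sum (I : Type) (s : seq I) (P : pred I) (F : I -> C) :
  modc (\sum_(i <- s | P i) F i) <= \sum_(i <- s | P i) modc (F i).
Proof.
elim/big_ind2: _ => [|x1 x2 y1 y2 h1 h2|//]; first by rewrite modc0.
exact: le_trans (modcD _ _) (lerD h1 h2).
Qed.
Lemma modc_prod (I : Type) (s : seq I) (P : pred I) (F : I -> C) :
  modc (\prod_(i <- s | P i) F i) = \prod_(i <- s | P i) modc (F i).
Proof. by elim/big_ind2: _ => [|x1 x2 y1 y2 <- <-|//]; rewrite ?modc1 ?modcM. Qed.
Lemma modc_real (x : R) : modc (x%:C)%C = `|x|.
Proof. by rewrite /modc /Normc.normc /= expr0n /= addr0 sqrtr_sqr. Qed.
Lemma natr_complex n : (n%:R : C) = (n%:R%:C)%C.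
Proof. by rewrite rmorph_nat. Qed.
Lemma modc_nat n : modc n%:R = n%:R.
Proof. by rewrite natr_complex modc_real ger0_norm. Qed.

Lemma geo_small (q e : R) : 0 <= q < 1 -> 0 < e -> exists n, q ^+ n < e.
Proof.
move=> /andP[q0 q1] e0.
have : `|q| < 1 by rewrite ger0_norm.
move=> /cvg_expr /cvgrPdist_lt /(_ e e0) [n _ /(_ n (leqnn n))] /=.
rewrite sub0r normrN ger0_norm ?exprn_ge0 // => h; by exists n.
Qed.

Lemma le_geo (q x y K : R) : 0 <= q < 1 ->
  (forall n, x <= y + K * q ^+ n) -> x <= y.
Proof.
move=> q01 h; rewrite leNgt; apply/negP => xy.
have K0 : 0 < 1 + `|K| by rewrite ltr_pwDl.
have xy0 : 0 < (x - y) / (1 + `|K|) by rewrite divr_gt0 // subr_gt0.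
have [n] := geo_small q01 xy0.
rewrite ltr_pdivlMr // => hn.
have qn0 : 0 <= q ^+ n by rewrite exprn_ge0 //; case/andP: q01.
have := h n; have : K * q ^+ n <= `|K| * q ^+ n by rewrite ler_wpM2r // ler_norm.
lra.
Qed.
End ComplexModulus.

Arguments modc {R} z : simpl never.

(** * Cauchy products and their truncated sums *)

Section Convolution.
Variable A : comNzRingType.
Implicit Types a b : nat -> A.

Definition conv a b n : A := \sum_(i < n.+1) a i * b (n - i)%N.
Definition psum a (z : A) n : A := \sum_(i < n) a i * z ^+ i.

Lemma convC a b n : conv a b n = conv b a n.
Proof.
rewrite /conv (reindex_inj rev_ord_inj) /=; apply: eq_bigr => i _.
by rewrite mulrC subSS subKn // -ltnS.
Qed.

Lemma psum_nat a z n : psum a z n = \sum_(0 <= i < n) a i * z ^+ i.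
Proof. by rewrite big_mkord. Qed.

(** The triangle of terms is grouped by the index of [a], so each a_i z^i meets a truncation of [b].
    Norm and convergence of products then reduce to finite sums. *)
Lemma psum_conv a b z n :
  psum (conv a b) z n = \sum_(i < n) a i * z ^+ i * psum b z (n - i).
Proof.
elim: n => [|n IH]; first by rewrite /psum !big_ord0.
have psumS c m : psum c z m.+1 = psum c z m + c m * z ^+ m.
  by rewrite /psum big_ord_recr.
have ps0 c : psum c z 0 = 0 by rewrite /psum big_ord0.
rewrite psumS IH [RHS]big_ord_recr /= subSn // subnn psumS ps0 add0r.
rewrite expr0 mulr1 {1}/conv big_ord_recr /= subnn.
rewrite mulrDl addrA mulrAC; congr (_ + _).
rewrite mulr_suml -big_split /=; apply: eq_bigr => i _.
rewrite subSn 1?ltnW // psumS mulrDr; congr (_ + _).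
have {1}-> : z ^+ n = z ^+ i * z ^+ (n - i) by rewrite -exprD subnKC // ltnW.
ring.
Qed.

End Convolution.

(** * Laurent expansions with a weighted l^1 bound *)

Section WeightedSeries.
Variable R : realType.
Local Notation C := (R[i]).
Implicit Types (r B : R) (a b : nat -> C) (f g : C -> C).

(** The weighted l^1 norm is at most [B], stated through partial sums so that no infinite sum
    occurs. *)
Definition wbound r B a := forall n, psum (fun i => modc (a i)) r n <= B.

(** The series of [a] at [z] has sum [v]. Convergence is required at the geometric rate |z|/r, which
    a finite norm at [r] yields anyway and which multiplies well. *)
Definition gsum r a (z v : C) :=
  exists K : R, forall n, modc (v - psum a z n) <= K * (modc z / r) ^+ n.

(** f(z) = z^-m sum a_i z^i on 0 < |z| < r, with norm at most [B]; [m] bounds the pole order and may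
    exceed it. *)
Definition lexp r B (m : nat) a f :=
  wbound r B a /\
  forall z, 0 < modc z -> modc z < r -> gsum r a z (f z * z ^+ m).

Lemma wbound_ge0 r B a : wbound r B a -> 0 <= B.
Proof. by move=> /(_ 0%N); rewrite /psum big_ord0. Qed.

Lemma wbound_coef r B a n : 0 <= r -> wbound r B a -> modc (a n) * r ^+ n <= B.
Proof.
move=> r0 /(_ n.+1); rewrite /psum big_ord_recr /=; apply: le_trans.
by rewrite lerDr sumr_ge0 // => i _; rewrite mulr_ge0 ?modc_ge0 ?exprn_ge0.
Qed.

Lemma ratio01 r (z : C) : 0 < r -> modc z < r -> 0 <= modc z / r < 1.
Proof.
by move=> r0 zr; rewrite divr_ge0 ?modc_ge0 ?(ltW r0) //= ltr_pdivrMr ?mul1r.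
Qed.

(** For i >= n, |z|^i = r^i (|z|/r)^i <= r^i (|z|/r)^n. *)
Lemma modc_psum_tail r B a z n p : 0 < r -> modc z < r -> wbound r B a ->
  (n <= p)%N -> modc (psum a z p - psum a z n) <= B * (modc z / r) ^+ n.
Proof.
move=> r0 zr ab np; have /andP[q0 q1] := ratio01 r0 zr.
have qn0 := exprn_ge0 n q0.
apply: le_trans (ler_wpM2r qn0 (ab p)).
rewrite !psum_nat.
rewrite (big_cat_nat (n := n)) //= addrAC subrr add0r.
apply: le_trans (modc_sum _ _ _) _.
rewrite [X in _ <= X * _](big_cat_nat (n := n)) //= mulrDl ler_wpDl //.
  by rewrite mulr_ge0 // sumr_ge0 // => i _; rewrite mulr_ge0 ?modc_ge0 // exprn_ge0 // ltW.
rewrite mulr_suml big_nat_cond [leRHS]big_nat_cond; apply: ler_sum => i /andP[/andP[ni _] _].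
rewrite modcM modcX -mulrA ler_wpM2l ?modc_ge0 //.
rewrite -{1}(divfK (lt0r_neq0 r0) (modc z)) exprMn mulrC ler_wpM2l ?exprn_ge0 ?(ltW r0) //.
by rewrite ler_wiXn2l // ltW.
Qed.

(** Letting p grow in [modc_psum_tail] upgrades plain convergence to a geometric rate with constant
    [B]. *)
Lemma gsum_lim r B a z v : 0 < r -> modc z < r -> wbound r B a ->
  (forall e : R, 0 < e -> exists n0, forall n, (n0 <= n)%N -> modc (v - psum a z n) < e) ->
  forall n, modc (v - psum a z n) <= B * (modc z / r) ^+ n.
Proof.
move=> r0 zr ab h n; apply/ler_addgt0Pr => e e0.
have [n0 hn0] := h e e0.
have := hn0 (maxn n n0) (leq_maxr _ _).
have := modc_psum_tail r0 zr ab (leq_maxl n n0).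
set p := psum a z (maxn _ _) => h1 h2.
have -> : v - psum a z n = (v - p) + (p - psum a z n) by ring.
apply: le_trans (modcD _ _) _; rewrite addrC lerD //; exact: ltW.
Qed.

(** Any constant K forces convergence, hence may be replaced by [B], which does not depend on
    [z]. *)
Lemma gsum_sharp r B a z v : 0 < r -> modc z < r -> wbound r B a -> gsum r a z v ->
  forall n, modc (v - psum a z n) <= B * (modc z / r) ^+ n.
Proof.
move=> r0 zr ab [K hK]; apply: gsum_lim => // e e0.
have q01 := ratio01 r0 zr; have [q0 q1] := andP q01.
have K0 : 0 < 1 + `|K| by rewrite ltr_pwDl.
have [n hn] := geo_small q01 (divr_gt0 e0 K0).
exists n => p np; apply: le_lt_trans (hK p) _.
rewrite ltr_pdivlMr // in hn; apply: le_lt_trans hn.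
have : (modc z / r) ^+ p <= (modc z / r) ^+ n by rewrite ler_wiXn2l // ltW.
have := exprn_ge0 p q0; have := exprn_ge0 n q0; have := ler_norm K; have := normr_ge0 K.
set x := _ ^+ n; set y := _ ^+ p; move=> *; nra.
Qed.

Lemma modc_conv a b n :
  modc (conv a b n) <= conv (fun i => modc (a i)) (fun i => modc (b i)) n.
Proof. by apply: le_trans (modc_sum _ _ _) _; apply: ler_sum => i _; rewrite modcM. Qed.

Lemma psum_le (u w : nat -> R) r n : 0 <= r -> (forall i, u i <= w i) ->
  psum u r n <= psum w r n.
Proof. by move=> r0 uw; apply: ler_sum => i _; rewrite ler_wpM2r ?exprn_ge0. Qed.

Lemma psum_ge0 (u : nat -> R) r n : 0 <= r -> (forall i, 0 <= u i) -> 0 <= psum u r n.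
Proof. by move=> r0 uw; apply: sumr_ge0 => i _; rewrite mulr_ge0 ?exprn_ge0. Qed.

Lemma wbound_conv r B B' a b : 0 <= r -> wbound r B a -> wbound r B' b ->
  wbound r (B * B') (conv a b).
Proof.
move=> r0 ha hb n; have B0 := wbound_ge0 ha; have B'0 := wbound_ge0 hb.
apply: le_trans (psum_le _ r0 (modc_conv a b)) _; rewrite psum_conv.
apply: (@le_trans _ _ (\sum_(i < n) modc (a i) * r ^+ i * B')).
  by apply: ler_sum => i _; rewrite ler_wpM2l ?hb // mulr_ge0 ?modc_ge0 ?exprn_ge0.
by rewrite -mulr_suml ler_wpM2r // ha.
Qed.

(** The error splits into (v - a-sum) w and terms a_i z^i times the error of the [b]-sum of length n
    - i. In the latter the rates recombine: |z|^i q^(n-i) = r^i q^n with q = |z|/r. *)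
Lemma gsum_conv r B B' a b z v w : 0 < r -> modc z < r ->
  wbound r B a -> wbound r B' b -> gsum r a z v -> gsum r b z w ->
  gsum r (conv a b) z (v * w).
Proof.
move=> r0 zr ha hb ga gb.
have ga' := gsum_sharp r0 zr ha ga; have gb' := gsum_sharp r0 zr hb gb.
have /andP[q0 q1] := ratio01 r0 zr; have B0 := wbound_ge0 ha; have B'0 := wbound_ge0 hb.
exists (B * modc w + B * B') => n; rewrite psum_conv.
have -> : v * w - \sum_(i < n) a i * z ^+ i * psum b z (n - i)
   = (v - psum a z n) * w + \sum_(i < n) a i * z ^+ i * (w - psum b z (n - i)).
  rewrite mulrBl /psum mulr_suml; under [X in _ = _ + X]eq_bigr do rewrite mulrBr.
  by rewrite sumrB; ring.
apply: le_trans (modcD _ _) _; rewrite modcM [leRHS]mulrDl; apply: lerD.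
  by rewrite mulrAC ler_wpM2r ?modc_ge0 // ga'.
apply: le_trans (modc_sum _ _ _) _.
apply: (@le_trans _ _ (\sum_(i < n) modc (a i) * r ^+ i * (B' * (modc z / r) ^+ n))); last first.
  by rewrite -mulr_suml -[leRHS]mulrA ler_wpM2r ?ha // mulr_ge0 ?exprn_ge0.
apply: ler_sum => i _; rewrite !modcM modcX -!mulrA ler_wpM2l ?modc_ge0 //.
rewrite -{1}(divfK (lt0r_neq0 r0) (modc z)) exprMn [_ * r ^+ i]mulrC -mulrA.
rewrite ler_wpM2l ?exprn_ge0 ?(ltW r0) //.
rewrite -[in leRHS](subnKC (ltnW (ltn_ord i))) exprD (mulrCA B') ler_wpM2l ?exprn_ge0 //.
Qed.

Lemma lexp_mul r B B' m p a b f g : 0 < r -> lexp r B m a f -> lexp r B' p b g ->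
  lexp r (B * B') (m + p) (conv a b) (fun z => f z * g z).
Proof.
move=> r0 [ha fa] [hb gb]; split; first by apply: wbound_conv => //; exact: ltW.
move=> z z0 zr; rewrite exprD mulrACA.
by apply: gsum_conv ha hb (fa _ _ _) (gb _ _ _).
Qed.

Lemma psumD a b z n : psum (fun i => a i + b i) z n = psum a z n + psum b z n.
Proof. by rewrite /psum -big_split /=; apply: eq_bigr => i _; rewrite mulrDl. Qed.

Lemma psumZ c a z n : psum (fun i => c * a i) z n = c * psum a z n.
Proof. by rewrite /psum mulr_sumr; apply: eq_bigr => i _; rewrite mulrA. Qed.

Lemma lexp_add r B B' m a b f g : 0 < r -> lexp r B m a f -> lexp r B' m b g ->
  lexp r (B + B') m (fun i => a i + b i) (fun z => f z + g z).
Proof.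
move=> r0 [ha fa] [hb gb]; split.
  move=> n; apply: le_trans (lerD (ha n) (hb n)).
  rewrite /psum -big_split /=; apply: ler_sum => i _.
  by rewrite -mulrDl ler_wpM2r ?modcD // exprn_ge0 // ltW.
move=> z z0 zr; have [K hK] := fa z z0 zr; have [K' hK'] := gb z z0 zr.
exists (K + K') => n; rewrite psumD mulrDl.
rewrite opprD addrACA; apply: le_trans (modcD _ _) _.
by rewrite mulrDl lerD.
Qed.

Lemma lexp_scale r B m c a f : 0 < r -> lexp r B m a f ->
  lexp r (modc c * B) m (fun i => c * a i) (fun z => c * f z).
Proof.
move=> r0 [ha fa]; split.
  move=> n; apply: le_trans (ler_wpM2l (modc_ge0 c) (ha n)).
  by rewrite /psum mulr_sumr; apply: ler_sum => i _; rewrite modcM mulrA.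
move=> z z0 zr; have [K hK] := fa z z0 zr.
exists (modc c * K) => n; rewrite psumZ -mulrA -mulrBr modcM -mulrA.
by rewrite ler_wpM2l ?modc_ge0.
Qed.

Lemma lexp_eq r B m a f g : (forall z, 0 < modc z -> modc z < r -> f z = g z) ->
  lexp r B m a f -> lexp r B m a g.
Proof. by move=> fg [ha fa]; split=> // z z0 zr; rewrite -fg //; exact: fa. Qed.

Lemma lexp_eqc r B m a b f : a =1 b -> lexp r B m a f -> lexp r B m b f.
Proof.
move=> ab [ha fa]; have ps n z : psum a z n = psum b z n.
  by apply: eq_bigr => i _; rewrite ab.
split=> [n|z z0 zr].
  by have := ha n; congr (_ <= _); apply: eq_bigr => i _; rewrite ab.
by have [K hK] := fa z z0 zr; exists K => n; rewrite -ps.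
Qed.

Lemma lexp_radius r r' B m a f : 0 < r' -> r' <= r -> lexp r B m a f -> lexp r' B m a f.
Proof.
move=> r0 rr [ha fa]; split.
  move=> n; apply: le_trans (ha n); apply: ler_sum => i _.
  by rewrite ler_wpM2l ?modc_ge0 // lerXn2r // nnegrE ?(ltW r0) // (le_trans (ltW r0)).
move=> z z0 zr; have [K hK] := fa z z0 (lt_le_trans zr rr); exists `|K| => n.
apply: le_trans (hK n) _.
have r1 : 0 < r by apply: lt_le_trans rr.
apply: (@le_trans _ _ (`|K| * (modc z / r) ^+ n)).
  by rewrite ler_wpM2r ?ler_norm // exprn_ge0 // divr_ge0 ?modc_ge0 // ltW.
have zr' : modc z / r <= modc z / r' by rewrite ler_wpM2l ?modc_ge0 // lef_pV2.
rewrite ler_wpM2l //; apply: lerXn2r => //.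
  by rewrite nnegrE divr_ge0 ?modc_ge0 // ltW.
by rewrite nnegrE divr_ge0 ?modc_ge0 // ltW.
Qed.

(** Multiplication of the series by z. Besides, for an expansion of pole order [m], the value
    [shiftc a m] is the coefficient of 1/z: a_(m-1), or 0 if m = 0. *)
Definition shiftc a i : C := if i is i'.+1 then a i' else 0.

Lemma psum_shiftc a z n : psum (shiftc a) z n.+1 = z * psum a z n.
Proof.
rewrite /psum big_ord_recl /= mul0r add0r mulr_sumr; apply: eq_bigr => i _.
by rewrite exprS mulrCA.
Qed.

Lemma gsum_shiftc r a z v : 0 < r -> 0 < modc z -> gsum r a z v -> gsum r (shiftc a) z (v * z).
Proof.
move=> r0 z0 [K hK]; exists (modc z * modc v + r * K) => -[|n].
  rewrite /psum big_ord0 subr0 expr0 mulr1 modcM mulrC lerDl mulr_ge0 ?(ltW r0) //.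
  by have := hK 0%N; rewrite expr0 mulr1; apply: le_trans; exact: modc_ge0.
rewrite psum_shiftc (mulrC v) -mulrBr modcM mulrDl ler_wpDl //.
  by rewrite !mulr_ge0 ?modc_ge0 // exprn_ge0 // divr_ge0 ?modc_ge0 // ltW.
apply: le_trans (ler_wpM2l (modc_ge0 z) (hK n)) _.
rewrite exprS le_eqVlt; apply/orP; left; apply/eqP; field; exact: lt0r_neq0.
Qed.

(** Overstating the pole order brings two expansions to a common order before they are added or
    compared. *)
Lemma lexp_raise r B m a f : 0 < r -> lexp r B m a f -> lexp r (r * B) m.+1 (shiftc a) f.
Proof.
move=> r0 [ha fa]; split.
  case=> [|n]; first by rewrite /psum big_ord0 mulr_ge0 ?(ltW r0) // (wbound_ge0 ha).
  rewrite /psum big_ord_recl [shiftc a _]/= modc0 mul0r add0r.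
  apply: le_trans (ler_wpM2l (ltW r0) (ha n)).
  by rewrite mulr_sumr; apply: ler_sum => i _; rewrite exprS mulrCA.
by move=> z z0 zr; rewrite exprSr mulrA; apply: gsum_shiftc => //; exact: fa.
Qed.

Lemma lexp_divz r B a f : 0 < r -> a 0%N = 0 -> lexp r B 0 a f ->
  lexp r (B / r) 0 (fun i => a i.+1) (fun z => f z / z).
Proof.
move=> r0 a0 [ha fa]; split.
  move=> n; rewrite ler_pdivlMr //; apply: le_trans (ha n.+1).
  rewrite /psum big_ord_recl /= a0 modc0 mul0r add0r mulr_suml.
  by apply: ler_sum => i _; rewrite exprSr mulrA.
move=> z z0 zr; have [K hK] := fa z z0 zr; exists (K / r) => n.
have zn0 : z != 0 by rewrite -modc_gt0.
have := hK n.+1; rewrite !expr0 !mulr1.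
have -> : psum a z n.+1 = z * psum (fun i => a i.+1) z n.
  rewrite /psum big_ord_recl /= a0 mul0r add0r mulr_sumr.
  by apply: eq_bigr => i _; rewrite exprS mulrCA.
have -> : f z - z * psum (fun i : nat => a i.+1) z n
     = z * (f z / z - psum (fun i : nat => a i.+1) z n).
  by field.
rewrite modcM exprS => h; rewrite -(ler_pM2l z0); apply: le_trans h _.
rewrite le_eqVlt; apply/orP; left; apply/eqP; field; exact: lt0r_neq0.
Qed.

Definition cst_seq (c : C) i : C := if i is 0%N then c else 0.

Lemma lexp_cst r c : 0 < r -> lexp r (modc c) 0 (cst_seq c) (fun=> c).
Proof.
move=> r0; split.
  case=> [|n]; first by rewrite /psum big_ord0 modc_ge0.
  by rewrite /psum big_ord_recl expr0 mulr1 big1 ?addr0 // => i _; rewrite /= modc0 mul0r.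
move=> z z0 zr; exists (modc c) => -[|n].
  by rewrite /psum big_ord0 subr0 !expr0 !mulr1.
rewrite /psum big_ord_recl !expr0 !mulr1 big1 ?addr0 => [|i _]; last by rewrite mul0r.
rewrite subrr modc0 mulr_ge0 ?modc_ge0 // exprn_ge0 // divr_ge0 ?modc_ge0 //; exact: ltW.
Qed.

End WeightedSeries.

(** * Limits and punctured neighbourhoods in epsilon form *)

Section LaurentTopology.
Variable K : numFieldType.
Implicit Types (P : K -> Prop) (u : nat -> K) (l : K).

Lemma dnbhs0P P : (\forall z \near ((0 : K)^')%classic, P z) <->
  exists2 e : K, 0 < e & forall z, z != 0 -> `|z| < e -> P z.
Proof.
split.
  move=> /nbhs_ballP [e /= e0 h]; exists e => // z z0 ze; apply: h => //.
  by rewrite /ball /= sub0r normrN.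
move=> [e e0 h]; apply/nbhs_ballP; exists e => //= z.
by rewrite /ball /= sub0r normrN => ze z0; apply: h.
Qed.

Lemma seriesP u l : (series u @ \oo --> l)%classic <->
  forall e : K, 0 < e -> exists n0, forall n, (n0 <= n)%N -> `|l - \sum_(i < n) u i| < e.
Proof.
split.
  move=> /cvgrPdist_lt h e /h [n0 _ hn]; exists n0 => n nn; have := hn n nn.
  by rewrite /= /series /= big_mkord.
move=> h; apply/cvgrPdist_lt => e /h [n0 hn]; exists n0 => // n nn.
by rewrite /= /series /= big_mkord; exact: hn.
Qed.
End LaurentTopology.

(** * Reciprocals of power series *)

Section Inversion.
Variable R : realType.
Local Notation C := (R[i]).
Implicit Types (r B : R) (a b : nat -> C) (f g : C -> C).

(** Each new coefficient of the reciprocal depends on all earlier ones, so structural recursion has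
    to carry the whole prefix. *)
Fixpoint inv_prefix a n : seq C :=
  if n is m.+1 then
    let s := inv_prefix a m in
    rcons s (- (a 0%N)^-1 * \sum_(i < m.+1) a i.+1 * nth 0 s (m - i)%N)
  else [:: (a 0%N)^-1].

Definition inv_coef a n := nth 0 (inv_prefix a n) n.

Lemma size_inv_prefix a n : size (inv_prefix a n) = n.+1.
Proof. by elim: n => //= n IH; rewrite size_rcons IH. Qed.

Lemma nth_inv_prefix a n i : (i <= n)%N -> nth 0 (inv_prefix a n) i = inv_coef a i.
Proof.
elim: n => [|n IH]; first by rewrite leqn0 => /eqP ->.
rewrite leq_eqVlt => /orP[/eqP -> //|]; rewrite ltnS => le_in.
by rewrite /= nth_rcons size_inv_prefix ltnS le_in IH.
Qed.

Lemma inv_coefS a n :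
  inv_coef a n.+1 = - (a 0%N)^-1 * \sum_(i < n.+1) a i.+1 * inv_coef a (n - i)%N.
Proof.
rewrite {1}/inv_coef /= nth_rcons size_inv_prefix ltnn eqxx; congr (_ * _).
by apply: eq_bigr => i _; rewrite nth_inv_prefix // leq_subr.
Qed.

Lemma conv_inv_coef a n : a 0%N != 0 -> conv a (inv_coef a) n = (n == 0%N)%:R.
Proof.
move=> a0; case: n => [|n]; first by rewrite /conv big_ord1 subn0 /inv_coef /= divff.
rewrite /conv big_ord_recl subn0 inv_coefS mulrA mulrN divff // mulN1r.
under [X in _ + X]eq_bigr do rewrite /= subSS.
by rewrite addNr.
Qed.

(** A Neumann series estimate on truncations: weighting and summing the recursion gives |a_0| T <= 1
    + theta |a_0| T for the truncated norm T of the reciprocal, and T is finite, so it can be solved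
    for. *)
Lemma wbound_inv r theta a : 0 < r -> a 0%N != 0 -> theta < 1 ->
  (forall n, r * psum (fun i => modc (a i.+1)) r n <= theta * modc (a 0%N)) ->
  wbound r ((modc (a 0%N))^-1 / (1 - theta)) (inv_coef a).
Proof.
move=> r0 a0 t1 ht n; set b := inv_coef a.
have ma0 : 0 < modc (a 0%N) by rewrite modc_gt0.
pose a' i := if i is i'.+1 then modc (a i'.+1) else 0.
have a'0 i : 0 <= a' i by case: i => //= i; exact: modc_ge0.
pose d i : R := (i == 0%N)%:R.
have hb l : modc (a 0%N) * modc (b l) <= d l + conv a' (fun i => modc (b i)) l.
  have : a 0%N * b l = (l == 0%N)%:R - \sum_(i < l) a i.+1 * b (l - i.+1)%N.
    rewrite -(conv_inv_coef l a0) -/b /conv big_ord_recl subn0.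
    by under eq_bigr do rewrite /= /bump /= add1n; rewrite addrK.
  move=> /(congr1 (@modc R)); rewrite modcM => ->.
  apply: (le_trans (modcB _ _)); rewrite modc_nat lerD2l /conv big_ord_recl /= mul0r add0r.
  apply: le_trans (modc_sum _ _ _) _; apply: ler_sum => i _.
  by rewrite modcM /= /bump add1n.
have T0 m : 0 <= psum (fun i => modc (b i)) r m.
  by exact: psum_ge0 (ltW r0) (fun i => modc_ge0 (b i)).
have Tm m : (m <= n)%N -> psum (fun i => modc (b i)) r m <= psum (fun i => modc (b i)) r n.
  move=> mn; rewrite !psum_nat [leRHS](big_cat_nat (n := m)) //= lerDl sumr_ge0 // => i _.
  by rewrite mulr_ge0 ?modc_ge0 ?exprn_ge0 // ltW.
have : modc (a 0%N) * psum (fun i => modc (b i)) r n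
    <= 1 + theta * modc (a 0%N) * psum (fun i => modc (b i)) r n.
  have -> : modc (a 0%N) * psum (fun i => modc (b i)) r n
     = psum (fun i => modc (a 0%N) * modc (b i)) r n.
    by rewrite /psum mulr_sumr; apply: eq_bigr => i _; rewrite mulrA.
  apply: le_trans (psum_le _ (ltW r0) hb) _.
  have -> : psum (fun i => d i + conv a' (fun i => modc (b i)) i) r n
     = psum d r n + psum (conv a' (fun i => modc (b i))) r n.
    by rewrite /psum -big_split /=; apply: eq_bigr => i _; rewrite mulrDl.
  apply: lerD.
    rewrite /psum; case: (n) => [|m]; first by rewrite big_ord0.
    by rewrite big_ord_recl /= expr0 mulr1 big1 ?addr0 // => i _; rewrite mul0r.
  rewrite psum_conv.
  apply: (@le_trans _ _ (\sum_(i < n) a' i * r ^+ i * psum (fun i => modc (b i)) r n)).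
    apply: ler_sum => i _; rewrite ler_wpM2l ?Tm ?leq_subr //.
    by rewrite mulr_ge0 // exprn_ge0 // ltW.
  rewrite -mulr_suml ler_wpM2r //.
  case: (n) => [|m]; last first.
    apply: le_trans (ht m); rewrite big_ord_recl /= mul0r add0r /psum mulr_sumr.
    by apply: ler_sum => i _; rewrite exprS mulrCA.
  by rewrite big_ord0; have := ht 0%N; rewrite /psum big_ord0 mulr0.
set T := psum _ _ _ => hT.
have t1' : 0 < 1 - theta by rewrite subr_gt0.
rewrite -invfM -[leRHS]mulr1 ler_pdivlMl ?mulr_gt0 //.
lra.
Qed.

(** The product of the two series is exactly 1, so 1 - f(z) times a truncation of the reciprocal is
    a geometric error. At a zero of [f] this error would be constantly 1; elsewhere, dividing by
    f(z) gives the expansion of 1/f. *)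
Lemma lexp_inv r B theta a f : 0 < r -> lexp r B 0 a f -> a 0%N != 0 -> theta < 1 ->
  (forall n, r * psum (fun i => modc (a i.+1)) r n <= theta * modc (a 0%N)) ->
  lexp r ((modc (a 0%N))^-1 / (1 - theta)) 0 (inv_coef a) (fun z => (f z)^-1) /\
  forall z, 0 < modc z -> modc z < r -> f z != 0.
Proof.
move=> r0 [ha fa] a0 t1 ht; have wb := wbound_inv r0 a0 t1 ht.
set B' := _ / _ in wb *; set b := inv_coef a in wb *.
have B0 := wbound_ge0 ha; have B'0 := wbound_ge0 wb.
have key z : 0 < modc z -> modc z < r ->
    exists K, forall n, modc (1 - f z * psum b z n) <= K * (modc z / r) ^+ n.
  move=> z0 zr; have := fa z z0 zr; rewrite expr0 mulr1 => ga.
  have ga' := gsum_sharp r0 zr ha ga; have /andP[q0 q1] := ratio01 r0 zr.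
  exists (B' * B + 1) => -[|n].
    by rewrite /psum big_ord0 mulr0 subr0 modc1 expr0 mulr1 lerDr mulr_ge0.
  have : psum (conv b a) z n.+1 = 1.
    rewrite /psum big_ord_recl expr0 mulr1 convC conv_inv_coef //= big1 ?addr0 // => i _.
    by rewrite convC conv_inv_coef //= mul0r.
  rewrite psum_conv => one.
  have -> : 1 - f z * psum b z n.+1 = - \sum_(i < n.+1) b i * z ^+ i * (f z - psum a z (n.+1 - i)).
    rewrite -{1}one /psum; under [in RHS]eq_bigr do rewrite mulrBr.
    by rewrite sumrB -mulr_suml; ring.
  rewrite modcN; apply: le_trans (modc_sum _ _ _) _.
  apply: (@le_trans _ _ (B' * B * (modc z / r) ^+ n.+1)); last first.
    by rewrite ler_wpM2r ?exprn_ge0 // lerDl.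
  apply: (@le_trans _ _
    (\sum_(i < n.+1) modc (b i) * r ^+ i * (B * (modc z / r) ^+ n.+1))); last first.
    by rewrite -mulr_suml -[leRHS]mulrA ler_wpM2r ?wb // mulr_ge0 ?exprn_ge0.
  apply: ler_sum => i _; rewrite !modcM modcX -!mulrA ler_wpM2l ?modc_ge0 //.
  rewrite -{1}(divfK (lt0r_neq0 r0) (modc z)) exprMn [_ * r ^+ i]mulrC -mulrA.
rewrite ler_wpM2l ?exprn_ge0 ?(ltW r0) //.
  by rewrite -[in leRHS](subnKC (ltnW (ltn_ord i))) exprD (mulrCA B) ler_wpM2l ?exprn_ge0.
have fn0 z : 0 < modc z -> modc z < r -> f z != 0.
  move=> z0 zr; have [K hK] := key z z0 zr; apply/eqP => fz0.
  have : (1 : R) <= 0.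
    apply: (le_geo (ratio01 r0 zr) (K := K)) => n.
    by have := hK n; rewrite fz0 mul0r subr0 modc1 add0r.
  by rewrite ler10.
split=> //; split=> // z z0 zr; have [K hK] := key z z0 zr.
exists (modc (f z)^-1 * K) => n; rewrite expr0 mulr1.
have -> : (f z)^-1 - psum b z n = (f z)^-1 * (1 - f z * psum b z n).
  by field; exact: fn0.
by rewrite modcM -mulrA ler_wpM2l ?modc_ge0.
Qed.

End Inversion.

(** * Uniqueness of Laurent coefficients and evaluation of [residue0] *)

Section Residue.
Variable R : realType.
Local Notation C := (R[i]).
Implicit Types (r B : R) (a b : nat -> C) (f g : C -> C).

(** If a_i is the first nonzero coefficient, evaluation at a real t gives |a_i| t^i <= B
    (t/r)^(i+1). This fails for small t; [D] and [t] make the right side at most |a_i| t^i / 2. *)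
Lemma lexp0_coef r B m a : 0 < r -> lexp r B m a (fun=> 0) -> forall i, a i = 0.
Proof.
move=> r0 [ha fa]; elim/ltn_ind => i IH; apply/eqP; rewrite -modc_eq0.
have B0 := wbound_ge0 ha; apply: contraT; rewrite modc_eq0 -modc_gt0 => ai0.
pose D := B / r ^+ i.+1 + 1.
have D0 : 0 < D by rewrite ltr_wpDl // divr_ge0 // exprn_ge0 // ltW.
pose t := Num.min (r / 2) (modc (a i) / (2 * D)).
have t0 : 0 < t by rewrite lt_min !divr_gt0 ?mulr_gt0.
have tr : t < r.
  have : t <= r / 2 by rewrite ge_min lexx.
  lra.
have ta : t * (2 * D) <= modc (a i) by rewrite -ler_pdivlMr ?mulr_gt0 // ge_min lexx orbT.
have mt : modc (t%:C)%C = t by rewrite modc_real gtr0_norm.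
have := gsum_sharp r0 _ ha (fa (t%:C)%C _ _); rewrite mt => /(_ tr t0 tr i.+1).
rewrite /psum big_ord_recr /= big1 => [|j _]; last by rewrite IH // mul0r.
rewrite mul0r sub0r add0r modcN modcM modcX mt.
have -> : B * (t / r) ^+ i.+1 = (B / r ^+ i.+1 * t) * t ^+ i.
  rewrite exprMn exprVn exprS; field.
  by rewrite expf_neq0 // lt0r_neq0.
rewrite ler_pM2r ?exprn_gt0 // => h.
have : B / r ^+ i.+1 * t <= D * t by rewrite ler_wpM2r ?(ltW t0) // lerDl.
nra.
Qed.

Lemma lexp_raises r B m a f p : 0 < r -> lexp r B m a f ->
  exists B' a', lexp r B' (p + m) a' f /\ shiftc a' (p + m) = shiftc a m.
Proof.
move=> r0 fa; elim: p => [|p [B' [a' [fa' <-]]]]; first by exists B, a.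
by exists (r * B'), (shiftc a'); split; first exact: lexp_raise.
Qed.

Lemma lexp_unique r r' B B' m m' a b f : 0 < r -> 0 < r' ->
  lexp r B m a f -> lexp r' B' m' b f -> shiftc a m = shiftc b m'.
Proof.
move=> r0 r'0 fa fb; pose s := Num.min r r'.
have s0 : 0 < s by rewrite lt_min r0.
have sr : s <= r by rewrite ge_min lexx.
have sr' : s <= r' by rewrite ge_min lexx orbT.
have [B1 [a1 [fa1 <-]]] := lexp_raises m' s0 (lexp_radius s0 sr fa).
have [B2 [b1 [fb1 <-]]] := lexp_raises m s0 (lexp_radius s0 sr' fb).
rewrite addnC in fa1 *.
have := lexp_add s0 fa1 (lexp_scale (-1) s0 fb1).
move=> /(lexp_eq (g := fun=> 0)) h.
have {}h := lexp0_coef s0 (h (fun z _ _ => _)).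
case: (m + m')%N => //= i; apply/eqP; rewrite -subr_eq0 -mulN1r; apply/eqP.
by apply: h => z; rewrite mulN1r subrr.
Qed.

(** Abel's lemma: convergence at the point s bounds the terms there by M, so at radius s/2 the norm
    is dominated by a geometric series of sum 2M. *)
Lemma laurent_lexp f (a : int -> C) : laurent_expansion0 f a ->
  exists r B m b, [/\ 0 < r, lexp r B m b f & shiftc b m = a (- 1)].
Proof.
move=> [m [am /dnbhs0P [e e0 h]]].
have /complex_realP [e' ee] : e \is Num.real by rewrite realE ltW.
subst e; rewrite ltcR in e0.
have {}h z : 0 < modc z -> modc z < e' -> forall d : R, 0 < d ->
    exists n0, forall n, (n0 <= n)%N ->
      modc (f z - \sum_(i < n) a (i%:Z - m%:Z) * z ^ (i%:Z - m%:Z)) < d.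
  move=> z0 ze d d0.
  have zn0 : z != 0 by rewrite -modc_gt0.
  have := h z zn0; rewrite norm_modc ltcR => /(_ ze) /seriesP /(_ (d%:C)%C).
  rewrite ltcR => /(_ d0) [n0 hn].
  by exists n0 => n /hn; rewrite norm_modc ltcR.
pose s := e' / 2; have s0 : 0 < s by rewrite divr_gt0.
have se : s < e' by rewrite /s; lra.
pose z0 := (s%:C)%C : C; have mz0 : modc z0 = s by rewrite modc_real gtr0_norm.
pose b i := a (i%:Z - m%:Z).
have zm (z : C) i : z != 0 -> z ^ (i%:Z - m%:Z) = z ^+ i / z ^+ m.
  by move=> zn0; rewrite expfzDr // -exprnP -exprnN.
have z0n0 : z0 != 0 by rewrite -modc_gt0 mz0.
have [M hM] : exists M, forall i, modc (b i) * s ^+ i <= M.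
  have := h z0; rewrite mz0 => /(_ s0 se 1 ltr01) [n0 hn].
  pose T i := modc (a (i%:Z - m%:Z) * z0 ^ (i%:Z - m%:Z)).
  (* From [n0] on, a term is the difference of two partial sums that lie within 1 of f(z0); the
     finitely many earlier terms are bounded by their sum. *)
  exists ((2 + \sum_(j < n0) T j) * s ^+ m) => i.
  have -> : modc (b i) * s ^+ i = T i * s ^+ m.
    rewrite /T zm // modcM modcM modcV !modcX mz0; field.
    by rewrite expf_neq0 // lt0r_neq0.
  rewrite ler_wpM2r ?exprn_ge0 ?(ltW s0) //.
  have S0 : 0 <= \sum_(j < n0) T j by apply: sumr_ge0 => j _; exact: modc_ge0.
  case: (ltnP i n0) => [lt_in|le_ni].
    apply: (@le_trans _ _ (\sum_(j < n0) T j)); last by rewrite lerDr.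
    rewrite (bigD1 (Ordinal lt_in)) //= lerDl; apply: sumr_ge0 => j _; exact: modc_ge0.
  have := hn i le_ni; have := hn i.+1 (leqW le_ni).
  rewrite big_ord_recr /=; set x := \sum_(j < i) _; set y := a _ * _ => h1 h2.
  have -> : T i = modc ((f z0 - x) - (f z0 - (x + y))) by congr modc; rewrite -/y; ring.
  apply: le_trans (modcB _ _) _; lra.
have M0 : 0 <= M by have := hM 0%N; rewrite expr0 mulr1; apply: le_trans; exact: modc_ge0.
have hw : wbound (s / 2) (2 * M) b.
  move=> n; have : psum (fun i => modc (b i)) (s / 2) n <= 2 * M - 2 * M / 2 ^+ n.
    elim: n => [|n IH]; first by rewrite /psum big_ord0 expr0 divr1 subrr.
    rewrite /psum big_ord_recr /=; apply: le_trans (lerD IH (lexx _)) _.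
    have : modc (b n) * (s / 2) ^+ n <= M / 2 ^+ n by rewrite exprMn exprVn mulrA ler_wpM2r ?hM.
    have -> : 2 * M / 2 ^+ n.+1 = M / 2 ^+ n by rewrite exprS; field; rewrite expf_neq0.
    rewrite -[2 * M / 2 ^+ n]mulrA; lra.
  move=> H; apply: le_trans H _; rewrite gerBl divr_ge0 ?mulr_ge0 ?exprn_ge0 //.
exists (s / 2), (2 * M), m, b; split; first by rewrite divr_gt0.
  split=> // z zz0 zs.
  have s20 : 0 < s / 2 by rewrite divr_gt0.
  have zn0 : z != 0 by rewrite -modc_gt0.
  exists (2 * M); apply: gsum_lim => // d d0.
  have ze : modc z < e' by apply: lt_trans zs _; rewrite /s; lra.
  have [n0 hn] := h z zz0 ze (d / modc z ^+ m) (divr_gt0 d0 (exprn_gt0 _ zz0)).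
  exists n0 => n /hn; rewrite ltr_pdivlMr ?exprn_gt0 // -modcX -modcM.
  congr (modc _ < _); rewrite mulrBl; congr (_ - _).
  rewrite mulr_suml; apply: eq_bigr => i _; rewrite zm // /b; field.
  by rewrite expf_neq0.
rewrite /b; case: (m) am => [|m'] am' /=; first by rewrite am'.
by congr a; lia.
Qed.

Lemma lexp_laurent r B m a f : 0 < r -> lexp r B m a f ->
  exists2 b : int -> C, laurent_expansion0 f b & b (- 1) = shiftc a m.
Proof.
move=> r0 [ha fa].
exists (fun j : int => if 0 <= j + m%:Z then a `|(j + m%:Z)%R|%N else 0); last first.
  case: (m) => [//|m']; have -> : -1 + m'.+1%:Z = m'%:Z by lia.
  by [].
exists m; split=> [j jm|]; first by case: ifP => //; lia.
apply/dnbhs0P; exists (r%:C)%C; first by rewrite ltcR.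
move=> z zn0; rewrite norm_modc ltcR => zr.
have z0 : 0 < modc z by rewrite modc_gt0.
have q01 := ratio01 r0 zr; have [q0 q1] := andP q01.
have [K hK] := fa z z0 zr.
apply/seriesP => e e0.
have /complex_realP [e' ee] : e \is Num.real by rewrite realE ltW.
subst e; rewrite ltcR in e0.
have K0 : 0 < 1 + `|K| by rewrite ltr_pwDl.
have zm0 : 0 < modc z ^+ m by rewrite exprn_gt0.
have [n0 hn] := geo_small q01 (divr_gt0 (mulr_gt0 e0 zm0) K0).
exists n0 => n nn; rewrite norm_modc ltcR.
rewrite -(ltr_pM2r zm0) -modcX -modcM mulrBl.
have -> : (\sum_(i < n) (if 0 <= i%:Z - m%:Z + m%:Z then a `|(i%:Z - m%:Z + m%:Z)%R|%N else 0)
    * z ^ (i%:Z - m%:Z)) * z ^+ m = psum a z n.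
  rewrite mulr_suml; apply: eq_bigr => i _; rewrite subrK /= expfzDr // -exprnP -exprnN.
  by rewrite -mulrA divfK ?expf_neq0.
apply: le_lt_trans (hK n) _.
rewrite ltr_pdivlMr // in hn; rewrite modcX; apply: le_lt_trans hn.
have : (modc z / r) ^+ n <= (modc z / r) ^+ n0 by rewrite ler_wiXn2l // ltW.
have := exprn_ge0 n q0; have := exprn_ge0 n0 q0; have := ler_norm K; have := normr_ge0 K.
set x := _ ^+ n; set y := _ ^+ n0; move=> *; nra.
Qed.

(** [lexp_laurent] excludes the default value of [xget], and [laurent_lexp] with [lexp_unique] makes
    its choice irrelevant. *)
Lemma residue0_lexp r B m a f : 0 < r -> lexp r B m a f -> residue0 f = shiftc a m.
Proof.
move=> r0 fa; rewrite /residue0.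
have [b fb bE] := lexp_laurent r0 fa.
case: xgetP => [y _ [c /laurent_lexp [r' [B' [m' [a' [r'0 fa' <-]]]]] ->]|no].
  exact: lexp_unique fa' fa.
by case: (no (b (- 1))); exists b.
Qed.

End Residue.

(** * The power series of the complex exponential *)

Section ExponentialSeries.
Variable R : realType.
Local Notation C := (R[i]).
Implicit Types (r x y : R) (w z : C).
Local Open Scope complex_scope.

Definition exp_seq (F : fieldType) (w : F) i := w ^+ i / i`!%:R.

Lemma psum_exp_seq_le x n : 0 <= x -> psum (exp_seq x) 1 n <= expR x.
Proof.
move=> x0.
have nd : nondecreasing_seq (series (exp_coeff x)).
  by apply/nondecreasing_seqP => k; rewrite /series /= big_nat_recr //= lerDl exp_coeff_ge0.
have := nondecreasing_cvgn_le nd (@is_cvg_series_exp_coeff R x) n.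
rewrite /series /= big_mkord; apply: le_trans.
by rewrite /psum le_eqVlt; apply/orP; left; apply/eqP; apply: eq_bigr => i _; rewrite expr1n mulr1.
Qed.

Lemma modc_exp_seq w i : modc (exp_seq w i) = exp_seq (modc w) i.
Proof. by rewrite /exp_seq modcM modcV modcX modc_nat. Qed.

Lemma psum_exp_seq (F : fieldType) (w z : F) n :
  psum (exp_seq w) z n = psum (exp_seq (w * z)) 1 n.
Proof.
by apply: eq_bigr => i _; rewrite expr1n mulr1 /exp_seq exprMn mulrAC.
Qed.

Lemma wbound_exp_seq r w : 0 <= r -> wbound r (expR (modc w * r)) (exp_seq w).
Proof.
move=> r0 n; rewrite /wbound.
have -> : psum (fun i => modc (exp_seq w i)) r n = psum (exp_seq (modc w)) r n.
  by apply: eq_bigr => i _; rewrite modc_exp_seq.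
by rewrite psum_exp_seq psum_exp_seq_le // mulr_ge0 ?modc_ge0.
Qed.

Lemma conv_exp_seq w z n : conv (exp_seq w) (exp_seq z) n = exp_seq (w + z) n.
Proof.
rewrite /exp_seq addrC exprDn mulr_suml /conv; apply: eq_bigr => i _.
have le_in : (i <= n)%N by rewrite -ltnS.
have nz k : k`!%:R != 0 :> C by rewrite pnatr_eq0 -lt0n fact_gt0.
have bn : 'C(n, i)%:R != 0 :> C by rewrite pnatr_eq0 -lt0n bin_gt0.
rewrite -[_ *+ 'C(n, i)]mulr_natr -(bin_fact le_in) !natrM.
by field; rewrite !nz bn.
Qed.

Lemma cexp_real_imag w :
  cexp w = (expR (complex.Re w))%:C * (cos (complex.Im w) +i* sin (complex.Im w)).
Proof. by case: w => x y; rewrite /cexp; simpc. Qed.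

Lemma modc_le_ReIm w : modc w <= `|complex.Re w| + `|complex.Im w|.
Proof.
case: w => x y; change (modc (x +i* y) <= `|x| + `|y|).
have -> : x +i* y = x%:C + 'i * y%:C by simpc.
apply: le_trans (modcD _ _) _; rewrite modcM !modc_real lerD2l.
have -> : modc ('i : C) = 1 by rewrite /modc /= expr0n /= expr1n add0r sqrtr1.
by rewrite mul1r.
Qed.

Lemma gsum_exp_real x : gsum 2 (exp_seq x%:C) 1 (expR x)%:C.
Proof.
exists (expR (modc x%:C * 2)); apply: gsum_lim => //.
- by rewrite modc1 ltr1n.
- exact: wbound_exp_seq.
move=> e e0; have /seriesP /(_ e e0) [n0 hn] := @is_cvg_series_exp_coeff R x.
exists n0 => n /hn; rewrite -modc_real rmorphB.
congr (modc (_ - _) < _); rewrite rmorph_sum; apply: eq_bigr => i _.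
by rewrite expr1n mulr1 /exp_seq /exp_coeff /= rmorphM fmorphV rmorphXn rmorph_nat.
Qed.

Lemma exp_seq_imag y i :
  exp_seq (0 +i* y) i = cos_coeff y i +i* sin_coeff y i.
Proof.
have -> : exp_seq (0 +i* y) i = (exp_seq y i)%:C * 'i ^+ i.
  rewrite /exp_seq rmorphM fmorphV rmorphXn rmorph_nat mulrAC -exprMn.
  by congr (_ ^+ _ / _); simpc.
have -> : ('i : C) ^+ i = ((~~ odd i)%:R * (-1) ^+ i./2) +i* ((odd i)%:R * (-1) ^+ i.-1./2).
  rewrite -{1}(odd_double_half i) addnC exprD -mul2n exprM sqr_i.
  case: (boolP (odd i)) => oi.
    have -> : i.-1./2 = i./2 by rewrite -{1}(odd_double_half i) oi add1n /= doubleK.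
    rewrite expr1 mul0r mul1r.
    have -> : (-1) ^+ i./2 = ((-1) ^+ i./2)%:C :> C by rewrite rmorphXn rmorphN rmorph1.
    by simpc.
  rewrite expr0 mulr1 mul0r mul1r.
  by rewrite -[RHS]/(((-1) ^+ i./2)%:C) rmorphXn rmorphN rmorph1.
rewrite /exp_seq /cos_coeff /sin_coeff /=; simpc.
by congr (_ +i* _); rewrite -?exprnP; ring.
Qed.

Lemma gsum_exp_imag y : gsum 2 (exp_seq (0 +i* y)) 1 (cos y +i* sin y).
Proof.
exists (expR (modc (0 +i* y) * 2)); apply: gsum_lim => //.
- by rewrite modc1 ltr1n.
- exact: wbound_exp_seq.
move=> e e0; have e20 : 0 < e / 2 by rewrite divr_gt0.
have hc := @is_cvg_series_cos_coeff R y; have hs := @is_cvg_series_sin_coeff R y.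
have /seriesP /(_ _ e20) [n0 hn] : (series (cos_coeff y) @ \oo --> cos y)%classic.
  by rewrite unlock.
have /seriesP /(_ _ e20) [n1 hn1] : (series (sin_coeff y) @ \oo --> sin y)%classic.
  by rewrite unlock.
exists (maxn n0 n1) => n; rewrite geq_max => /andP[/hn h0 /hn1 h1].
have -> : psum (exp_seq (0 +i* y)) 1 n
    = (\sum_(i < n) cos_coeff y i) +i* (\sum_(i < n) sin_coeff y i).
  rewrite /psum; elim: n {h0 h1} => [|n IH]; first by rewrite !big_ord0.
  by rewrite !big_ord_recr /= IH expr1n mulr1 exp_seq_imag; simpc.
apply: le_lt_trans (modc_le_ReIm _) _; rewrite /=; lra.
Qed.

(** [cexp] is built from real functions; its series is the Cauchy product of those of e^(Re w) and
    e^(i Im w). Evaluating at 1 loses nothing, by [psum_exp_seq], and any radius above 1 would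
    do. *)
Lemma gsum_cexp w : gsum 2 (exp_seq w) 1 (cexp w).
Proof.
have m1 : modc (1 : C) < 2 by rewrite modc1 ltr1n.
have := gsum_conv _ m1 (wbound_exp_seq (complex.Re w)%:C _) (wbound_exp_seq (0 +i* complex.Im w) _)
   (gsum_exp_real (complex.Re w)) (gsum_exp_imag (complex.Im w)).
rewrite -cexp_real_imag => /(_ (ltr0Sn _ 1) (ler0n _ 2) (ler0n _ 2)) [K hK].
exists K => n; have := hK n; congr (modc (_ - _) <= _).
apply: eq_bigr => i _; rewrite conv_exp_seq; congr (exp_seq _ _ * _).
by case: (w) => x y; simpc.
Qed.

Lemma lexp_cexp r w : 0 < r ->
  lexp r (expR (modc w * r)) 0 (exp_seq w) (fun z => cexp (w * z)).
Proof.
move=> r0; have wb := wbound_exp_seq w (ltW r0); split=> // z z0 zr.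
rewrite expr0 mulr1; exists (expR (modc w * r)); apply: gsum_lim => // e e0.
have m1 : modc (1 : C) < 2 by rewrite modc1 ltr1n.
have gs := gsum_sharp _ m1 (wbound_exp_seq (w * z) _) (gsum_cexp (w * z)).
have {}gs := gs (ltr0Sn _ 1) (ler0n _ 2).
have q01 : 0 <= modc (1 : C) / 2 < (1 : R) by apply: ratio01.
have K0 : 0 < expR (modc (w * z) * 2) by exact: expR_gt0.
have [n0 hn] := geo_small q01 (divr_gt0 e0 K0).
exists n0 => n nn; rewrite psum_exp_seq; apply: le_lt_trans (gs n) _.
rewrite mulrC -ltr_pdivlMr //; apply: le_lt_trans hn.
by have /andP[q0 q1] := q01; rewrite ler_wiXn2l // ltW.
Qed.

Lemma cexpD w z : cexp (w + z) = cexp w * cexp z.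
Proof.
case: w z => [a b] [c d]; rewrite /cexp /= expRD cosD sinD; simpc.
by congr (_ +i* _); ring.
Qed.

Lemma cexp0 : cexp (0 : C) = 1.
Proof. by rewrite /cexp /= expR0 cos0 sin0 mulr0 mulr1. Qed.

Lemma cexp_natM n z : cexp (n%:R * z) = cexp z ^+ n.
Proof.
elim: n => [|n IH]; first by rewrite mul0r cexp0.
by rewrite -natr1 mulrDl mul1r cexpD IH exprSr.
Qed.

Lemma cexpN z : cexp (- z) = (cexp z)^-1.
Proof.
have h : cexp (- z) * cexp z = 1 by rewrite -cexpD addNr cexp0.
have z0 : cexp z != 0 by apply: contra_eq_neq h => ->; rewrite mulr0 eq_sym oner_eq0.
by apply: (mulIf z0); rewrite h mulVf.
Qed.

Lemma cexp_neq0 z : cexp z != 0.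
Proof.
have h : cexp (- z) * cexp z = 1 by rewrite -cexpD addNr cexp0.
by apply: contra_eq_neq h => ->; rewrite mulr0 eq_sym oner_eq0.
Qed.

End ExponentialSeries.

(** * Germs of meromorphic functions and linearity of the residue *)

Section ResidueCalculus.
Variable R : realType.
Local Notation C := (R[i]).
Implicit Types (f g : C -> C) (c w z : C).

Definition mero f := exists r B m a, 0 < r /\ lexp r B m a f.

(** [c] is the limit at 0. Only the punctured disc is examined, so removable singularities are
    included. *)
Definition holo f c := exists r B a, [/\ 0 < r, lexp r B 0 a f & a 0%N = c].

Definition germ_eq f g :=
  exists2 e : R, 0 < e & forall z, 0 < modc z -> modc z < e -> f z = g z.

Lemma mero_eq f g : germ_eq f g -> mero f -> mero g.
Proof.
move=> [e e0 fg] [r [B [m [a [r0 fa]]]]].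
have s0 : 0 < Num.min r e by rewrite lt_min r0.
have sr : Num.min r e <= r by rewrite ge_min lexx.
exists (Num.min r e), B, m, a; split=> //.
apply: lexp_eq (lexp_radius s0 sr fa) => z z0; rewrite lt_min => /andP[_ ze].
exact: fg.
Qed.

Lemma residue0_eq f g : germ_eq f g -> mero f -> residue0 f = residue0 g.
Proof.
move=> [e e0 fg] [r [B [m [a [r0 fa]]]]].
have s0 : 0 < Num.min r e by rewrite lt_min r0.
have sr : Num.min r e <= r by rewrite ge_min lexx.
rewrite (residue0_lexp r0 fa); apply/esym; apply: (residue0_lexp s0 (B := B)).
apply: lexp_eq (lexp_radius s0 sr fa) => z z0; rewrite lt_min => /andP[_ ze].
exact: fg.
Qed.

Lemma mero_mul f g : mero f -> mero g -> mero (fun z => f z * g z).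
Proof.
move=> [r [B [m [a [r0 fa]]]]] [r' [B' [m' [a' [r'0 ga]]]]].
have s0 : 0 < Num.min r r' by rewrite lt_min r0.
have sr : Num.min r r' <= r by rewrite ge_min lexx.
have sr' : Num.min r r' <= r' by rewrite ge_min lexx orbT.
exists (Num.min r r'), (B * B'), (m + m')%N, (conv a a'); split=> //.
by apply: lexp_mul => //; [exact: lexp_radius fa | exact: lexp_radius ga].
Qed.

Lemma holo_mul f g c w : holo f c -> holo g w -> holo (fun z => f z * g z) (c * w).
Proof.
move=> [r [B [a [r0 fa <-]]]] [r' [B' [a' [r'0 ga <-]]]].
have s0 : 0 < Num.min r r' by rewrite lt_min r0.
have sr : Num.min r r' <= r by rewrite ge_min lexx.
have sr' : Num.min r r' <= r' by rewrite ge_min lexx orbT.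
exists (Num.min r r'), (B * B'), (conv a a'); split=> //; last by rewrite /conv big_ord1.
by apply: (lexp_mul (m := 0) (p := 0)) => //; [exact: lexp_radius fa | exact: lexp_radius ga].
Qed.

Lemma common_lexp f g : mero f -> mero g -> exists r m B B' a a',
  [/\ 0 < r, lexp r B m a f & lexp r B' m a' g].
Proof.
move=> [r [B [m [a [r0 fa]]]]] [r' [B' [m' [a' [r'0 ga]]]]].
have s0 : 0 < Num.min r r' by rewrite lt_min r0.
have sr : Num.min r r' <= r by rewrite ge_min lexx.
have sr' : Num.min r r' <= r' by rewrite ge_min lexx orbT.
have [B1 [a1 [fa1 _]]] := lexp_raises m' s0 (lexp_radius s0 sr fa).
have [B2 [a2 [ga2 _]]] := lexp_raises m s0 (lexp_radius s0 sr' ga).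
rewrite addnC in fa1.
by exists (Num.min r r'), (m + m')%N, B1, B2, a1, a2.
Qed.

Lemma mero_residueD f g : mero f -> mero g ->
  mero (fun z => f z + g z) /\
  residue0 (fun z => f z + g z) = residue0 f + residue0 g.
Proof.
move=> mf mg; have [r [m [B [B' [a [a' [r0 fa ga]]]]]]] := common_lexp mf mg.
have h := lexp_add r0 fa ga; split; first by exists r, (B + B'), m, (fun i => a i + a' i).
rewrite (residue0_lexp r0 h) (residue0_lexp r0 fa) (residue0_lexp r0 ga).
by case: (m) => //=; rewrite addr0.
Qed.

Lemma mero_residueZ c f : mero f ->
  mero (fun z => c * f z) /\ residue0 (fun z => c * f z) = c * residue0 f.
Proof.
move=> [r [B [m [a [r0 fa]]]]]; have h := lexp_scale c r0 fa.
split; first by exists r, (modc c * B), m, (fun i => c * a i).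
rewrite (residue0_lexp r0 h) (residue0_lexp r0 fa).
by case: (m) => //=; rewrite mulr0.
Qed.

Lemma holo_mero f c : holo f c -> mero f.
Proof. by move=> [r [B [a [r0 fa _]]]]; exists r, B, 0%N, a. Qed.

Lemma residue0_holo f c : holo f c -> residue0 f = 0.
Proof. by move=> [r [B [a [r0 fa _]]]]; rewrite (residue0_lexp r0 fa). Qed.

Lemma holo_cst c : holo (fun=> c) c.
Proof.
by exists 1, (modc c), (cst_seq c); split=> //; exact: lexp_cst.
Qed.

Lemma holo_cexp w : holo (fun z => cexp (w * z)) 1.
Proof.
exists 1, (expR (modc w * 1)), (exp_seq w); split=> //; first exact: lexp_cexp.
by rewrite /exp_seq expr0 divr1.
Qed.

Lemma holo_add f g c w : holo f c -> holo g w -> holo (fun z => f z + g z) (c + w).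
Proof.
move=> [r [B [a [r0 fa <-]]]] [r' [B' [a' [r'0 ga <-]]]].
have s0 : 0 < Num.min r r' by rewrite lt_min r0.
have sr : Num.min r r' <= r by rewrite ge_min lexx.
have sr' : Num.min r r' <= r' by rewrite ge_min lexx orbT.
exists (Num.min r r'), (B + B'), (fun i => a i + a' i); split=> //.
by apply: lexp_add => //; [exact: lexp_radius fa | exact: lexp_radius ga].
Qed.

Lemma holo_eq f g c : (forall z, 0 < modc z -> f z = g z) -> holo f c -> holo g c.
Proof.
move=> fg [r [B [a [r0 fa <-]]]]; exists r, B, a; split=> //.
by apply: lexp_eq fa => z z0 _; exact: fg.
Qed.

Lemma lexp_inv_radius r B a f : 0 < r -> lexp r B 0 a f -> a 0%N != 0 ->
  exists s B', [/\ 0 < s, lexp s B' 0 (inv_coef a) (fun z => (f z)^-1) &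
    forall z, 0 < modc z -> modc z < s -> f z != 0].
Proof.
move=> r0 fa a0; have ma0 : 0 < modc (a 0%N) by rewrite modc_gt0.
have [ha _] := fa; have B0 := wbound_ge0 ha.
have Ba : modc (a 0%N) <= B by have := wbound_coef 0 (ltW r0) ha; rewrite expr0 mulr1.
(* At radius t r the nonconstant part has norm at most t B <= |a_0| / 2, whence theta = 1/2; the
   added 1 keeps the denominator positive. *)
pose t := modc (a 0%N) / (2 * (B + 1)).
have D0 : 0 < 2 * (B + 1) by rewrite mulr_gt0 // ltr_wpDl.
have t0 : 0 < t by rewrite divr_gt0.
have tB : t * (2 * (B + 1)) = modc (a 0%N) by rewrite /t divfK // lt0r_neq0.
have t1 : t <= 1 by rewrite /t ler_pdivrMr // mul1r; lra.
have s0 : 0 < t * r by rewrite mulr_gt0.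
have sr : t * r <= r by rewrite ler_piMl // ltW.
have half1 : (1 / 2 : R) < 1 by lra.
have hs n : t * r * psum (fun i => modc (a i.+1)) (t * r) n <= 1 / 2 * modc (a 0%N).
  apply: (@le_trans _ _ (t * B)); last by nra.
  rewrite -mulrA ler_wpM2l ?(ltW t0) //.
  apply: (@le_trans _ _ (r * psum (fun i => modc (a i.+1)) r n)).
    rewrite ler_wpM2l ?(ltW r0) //; apply: ler_sum => i _.
    by rewrite ler_wpM2l ?modc_ge0 // lerXn2r // nnegrE ltW.
  apply: le_trans (ha n.+1); rewrite /psum big_ord_recl /=.
  rewrite ler_wpDl ?mulr_ge0 ?modc_ge0 ?exprn_ge0 ?(ltW r0) //.
  by rewrite mulr_sumr; apply: ler_sum => i _; rewrite exprS mulrCA.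
have [h1 h2] := lexp_inv s0 (lexp_radius s0 sr fa) a0 half1 hs.
by eexists; eexists; split; [exact: s0 | exact: h1 | exact: h2].
Qed.

Lemma holo_inv f c : holo f c -> c != 0 -> holo (fun z => (f z)^-1) c^-1 /\
  exists2 e : R, 0 < e & forall z, 0 < modc z -> modc z < e -> f z != 0.
Proof.
move=> [r [B [a [r0 fa <-]]]] a0.
have [s [B' [s0 h1 h2]]] := lexp_inv_radius r0 fa a0.
by split; [exists s, B', (inv_coef a) | exists s].
Qed.

Lemma residue0_sum (I : eqType) (s : seq I) (F : I -> C -> C) :
  (forall i, i \in s -> mero (F i)) ->
  mero (fun z => \sum_(i <- s) F i z) /\
  residue0 (fun z => \sum_(i <- s) F i z) = \sum_(i <- s) residue0 (F i).
Proof.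
elim: s => [|i s IH] h.
  have h0 := holo_cst 0; rewrite big_nil.
  have -> : (fun z => \sum_(i <- [::]) F i z) = (fun=> 0) by apply/funext => z; rewrite big_nil.
  by split; [exact: holo_mero h0 | exact: residue0_holo h0].
have -> : (fun z => \sum_(j <- i :: s) F j z) = (fun z => F i z + \sum_(j <- s) F j z).
  by apply/funext => z; rewrite big_cons.
have [h1 h2] := IH (fun j js => h j (mem_behead (s := i :: s) js)).
have [h3 h4] := mero_residueD (h i (mem_head i s)) h1.
by split=> //; rewrite h4 h2 big_cons.
Qed.

End ResidueCalculus.

(** * The residue of x dz / (x - rho)^k along x = rho e^z *)

Section SimpleExponentialPole.
Variable R : realType.
Local Notation C := (R[i]).

(** Formal series are replaced by polynomials modulo 'X^M, where derivatives and ring identities are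
    available. *)
Definition tpoly (F : fieldType) M (a : nat -> F) : {poly F} := \poly_(i < M) a i.

Fixpoint cpow (F : fieldType) (a : nat -> F) k : nat -> F :=
  if k is k'.+1 then conv a (cpow a k') else fun i => (i == 0%N)%:R.

Lemma coef_modXn (F : fieldType) M (p : {poly F}) :
  (forall n, (n < M)%N -> p`_n = 0) -> exists g, p = 'X^M * g.
Proof.
move=> h; exists (drop_poly M p); rewrite -{1}(poly_take_drop M p) mulrC.
rewrite [X in X + _](_ : _ = 0) ?add0r //; apply/polyP => i.
by rewrite coef_take_poly coef0; case: ifP => // /h.
Qed.

Lemma coef_tpoly_conv (F : fieldType) M (a b : nat -> F) (p q : {poly F}) n :
  (forall i, (i < M)%N -> p`_i = a i) -> (forall i, (i < M)%N -> q`_i = b i) ->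
  (n < M)%N -> (p * q)`_n = conv a b n.
Proof.
move=> ha hb nM; rewrite coefM; apply: eq_bigr => i _.
have iM : (i < M)%N by apply: leq_trans nM; rewrite ltnS -ltnS.
by rewrite ha // hb // (leq_ltn_trans _ nM) // leq_subr.
Qed.

Lemma coef_tpoly_cpow (F : fieldType) M (a : nat -> F) (p : {poly F}) k n :
  (forall i, (i < M)%N -> p`_i = a i) -> (n < M)%N -> (p ^+ k)`_n = cpow a k n.
Proof.
move=> ha; elim: k n => [|k IH] n nM; first by rewrite expr0 coef1.
by rewrite exprS; exact: coef_tpoly_conv ha IH nM.
Qed.

(* With u = (e^z - 1)/z and v = 1/u one has e^z = u + z u', hence
   k e^z v^(k+1) = k v^k - z (v^k)', whose coefficient at z^k vanishes. *)
Lemma coef_exp_inv_pow (F : fieldType) (k : nat) (e u v : nat -> F) :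
  (forall i, e i = u i + i%:R * u i) -> (forall n, conv u v n = (n == 0%N)%:R) ->
  k%:R * conv e (cpow v k.+1) k = 0.
Proof.
move=> eu uv; case: k => [|k]; first by rewrite mul0r.
pose M := k.+2.
pose U := tpoly M u; pose V := tpoly M v; pose E := tpoly M e.
have cU i : (i < M)%N -> U`_i = u i by move=> h; rewrite coef_poly h.
have cV i : (i < M)%N -> V`_i = v i by move=> h; rewrite coef_poly h.
have cE i : (i < M)%N -> E`_i = e i by move=> h; rewrite coef_poly h.
rewrite -(coef_tpoly_conv cE (fun n => @coef_tpoly_cpow _ M v V k.+2 n cV)) //.
have [g hg] : exists g, U * V - 1 = 'X^M * g.
  apply: coef_modXn => n nM; rewrite coefB (coef_tpoly_conv cU cV nM) uv coef1.
  exact: subrr.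
have [h hh] : exists h, E - (U + 'X * U^`()) = 'X^M * h.
  apply: coef_modXn => n nM; rewrite coefB coefD coefXM cE // cU // eu.
  case: n nM => [|n] nM /=; first by rewrite mul0r subrr.
  by rewrite coef_deriv cU // mulr_natl subrr.
have [d hd] : exists d, 'X * (U^`() * V + U * V^`()) = 'X^M * d.
  have -> : U^`() * V + U * V^`() = (U * V - 1)^`() by rewrite derivB derivM derivC subr0.
  apply: coef_modXn => n nM; rewrite coefXM; case: n nM => [|n] nM //=.
  by rewrite hg coef_deriv coefXnM nM mul0rn.
(* All relations hold only modulo 'X^M, so their remainders g, h, d are carried along; M = k + 2 is
   just enough to read off the coefficient k + 1. *)
have key : k.+1%:R * (E * V ^+ k.+2) - (k.+1%:R * V ^+ k.+1 - 'X * (V ^+ k.+1)^`())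
   = 'X^M * (k.+1%:R * V ^+ k.+1 * g + k.+1%:R * V ^+ k.+1 * d
      - k.+1%:R * 'X * V ^+ k * V^`() * g + k.+1%:R * h * V ^+ k.+2).
  have -> : (V ^+ k.+1)^`() = k.+1%:R * (V^`() * V ^+ k) by rewrite deriv_exp mulr_natl.
  rewrite !mulrDr !mulrN.
  have -> : 'X^M * (k.+1%:R * V ^+ k.+1 * g) = k.+1%:R * V ^+ k.+1 * (U * V - 1).
    by rewrite hg; ring.
  have -> : 'X^M * (k.+1%:R * V ^+ k.+1 * d)
     = k.+1%:R * V ^+ k.+1 * ('X * (U^`() * V + U * V^`())) by rewrite hd; ring.
  have -> : 'X^M * (k.+1%:R * 'X * V ^+ k * V^`() * g)
     = k.+1%:R * 'X * V ^+ k * V^`() * (U * V - 1) by rewrite hg; ring.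
  have -> : 'X^M * (k.+1%:R * h * V ^+ k.+2)
     = k.+1%:R * V ^+ k.+2 * (E - (U + 'X * U^`())) by rewrite hh; ring.
  rewrite !exprS; ring.
have := congr1 (fun p : {poly F} => p`_k.+1) key.
rewrite coefXnM ltnSn !coefB coefXM /= coef_deriv.
have natM (n : nat) (p : {poly F}) i : (n%:R * p)`_i = n%:R * p`_i.
  by rewrite mulr_natl coefMn mulr_natl.
by rewrite !natM [_ * (V ^+ _)`__]mulr_natl subrr subr0.
Qed.

(** Up to a power of rho, the residue is the coefficient of z^(k-1) in e^z v^k with v = z/(e^z - 1),
    which [coef_exp_inv_pow] annihilates for k > 1. This is the formal counterpart of dx/(x - rho)^k
    being exact. *)
Lemma residue0_exp_pole (k : nat) (rho : C) : rho != 0 ->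
  residue0 (fun z => rho * cexp z / (rho * cexp z - rho) ^+ k) = (k == 1%N)%:R /\
  mero (fun z : C => (rho * cexp z - rho)^-1) /\
  exists2 e : R, 0 < e & forall z : C, 0 < modc z -> modc z < e -> rho * cexp z - rho != 0.
Proof.
move=> rho0.
pose u i : C := exp_seq 1 i.+1.
have u0 : u 0%N = 1 by rewrite /u /exp_seq expr1 divr1.
have [B hB] : exists B, lexp 1 B 0 (exp_seq (1 : C)) (fun z => cexp z).
  exists (expR (modc (1 : C) * 1)); have := @lexp_cexp R 1 1 ltr01.
  by apply: lexp_eq => z _ _; rewrite mul1r.
have [B' hu] : exists B', lexp 1 B' 0 u (fun z => (cexp z - 1) / z).
  have h1 := lexp_cst (-1 : C) (ltr01 : 0 < (1 : R)).
  have := lexp_divz ltr01 _ (lexp_add ltr01 hB h1).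
  rewrite /exp_seq expr0 divr1 subrr => /(_ erefl) h; eexists.
  by apply: lexp_eqc h => i; rewrite addr0.
have [s [B1 [s0 hv un0]]] : exists s B1, [/\ 0 < s,
    lexp s B1 0 (inv_coef u) (fun z : C => ((cexp z - 1) / z)^-1) &
    forall z : C, 0 < modc z -> modc z < s -> (cexp z - 1) / z != 0].
  by apply: lexp_inv_radius hu _ => //; rewrite u0 oner_eq0.
set v := inv_coef u in hv.
pose t := Num.min s 1.
have t0 : 0 < t by rewrite lt_min s0 ltr01.
have ts : t <= s by rewrite ge_min lexx.
have t1 : t <= 1 by rewrite ge_min lexx orbT.
have hv1 : lexp t B1 1 v (fun z : C => (cexp z - 1)^-1).
  have [w1 w2] := lexp_radius t0 ts hv; split=> // z z0 zt.
  by have := w2 z z0 zt; rewrite expr0 mulr1 expr1 invfM invrK.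
have hvk : exists B2, lexp t B2 k (cpow v k) (fun z : C => ((cexp z - 1) ^+ k)^-1).
  elim: k => [|k [B2 IH]].
    exists (modc (1 : C)).
    apply: lexp_eqc (lexp_eq _ (lexp_cst (1 : C) t0)); first by case.
    by move=> z _ _; rewrite expr0 invr1.
  exists (B1 * B2); have := lexp_mul t0 hv1 IH.
  by apply: lexp_eq => z _ _; rewrite exprS invfM.
have fac z : rho * cexp z - rho = rho * (cexp z - 1) by rewrite mulrBr mulr1.
split.
  have [B2 hk] := hvk.
  have := lexp_scale (rho / rho ^+ k) t0 (lexp_mul t0 (lexp_radius t0 t1 hB) hk).
  move=> /(lexp_eq (g := fun z => rho * cexp z / (rho * cexp z - rho) ^+ k)) h.
  have {}h := h (fun z _ _ => _).
  rewrite (residue0_lexp t0 (h _)); last first.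
    move=> z; rewrite fac exprMn invfM; ring.
  have uv n : conv u v n = (n == 0%N)%:R by rewrite conv_inv_coef // u0 oner_eq0.
  (* k' = k - 1 is the relevant index; k' = 0 is the simple pole, where the vanishing lemma says
     nothing and the coefficient is computed. *)
  case: (k) => [|k'] //=.
  have := @coef_exp_inv_pow C k' (exp_seq 1) u v _ uv.
  case: k' => [|k'] /=.
    move=> _; rewrite expr1 divff // mul1r /conv !big_ord1 /= mulr1 /exp_seq expr0 divr1 mul1r.
    by rewrite /v /inv_coef /= u0 invr1.
  have eu i : exp_seq (1 : C) i = u i + i%:R * u i.
    have nf : i`!%:R != 0 :> C by rewrite pnatr_eq0 -lt0n fact_gt0.
    have ni : i%:R + 1 != 0 :> C by rewrite natr1 pnatr_eq0.
    rewrite /u /exp_seq !expr1n factS natrM -natr1; field.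
    by rewrite nf ni.
  move=> /(_ eu) /eqP; rewrite mulf_eq0 pnatr_eq0 /= => /eqP ->; exact: mulr0.
split.
  have := mero_residueZ rho^-1
    (ex_intro _ t (ex_intro _ B1 (ex_intro _ 1%N (ex_intro _ v (conj t0 hv1))))).
  case=> + _; apply: mero_eq; exists 1 => // z _ _; by rewrite fac invfM.
exists s => // z z0 zs; rewrite fac mulf_neq0 //.
by apply: contraNneq (un0 z z0 zs) => ->; rewrite mul0r.
Qed.

End SimpleExponentialPole.

(** * The residue theorem for x^a / prod (x - q) and the partition recursion *)

Section ResidueSums.
Variable R : realType.
Local Notation C := (R[i]).
Implicit Types (f g : C -> C) (rho q z : C) (S l : seq C).

(** The differential x^a dx / prod (x - q) pulled back along x = rho e^z; since dx = x dz, the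
    exponent becomes a + 1. *)
Definition rfun l a rho z : C :=
  (rho * cexp z) ^+ a.+1 / \prod_(q <- l) (rho * cexp z - q).

Definition rsum S l a : C := \sum_(rho <- S) residue0 (rfun l a rho).

Lemma holo_circle rho : holo (fun z => rho * cexp z) rho.
Proof.
rewrite -[X in holo _ X]mulr1; apply: holo_mul; first exact: holo_cst.
by apply: holo_eq (holo_cexp 1) => z _; rewrite mul1r.
Qed.

Lemma holo_pow f c n : holo f c -> holo (fun z => f z ^+ n) (c ^+ n).
Proof.
move=> fc; elim: n => [|n IH].
  by rewrite expr0; apply: holo_eq (holo_cst 1) => z _; rewrite expr0.
by rewrite exprS; apply: holo_eq (holo_mul fc IH) => z _; rewrite exprS.
Qed.

Lemma holo_circle_pow rho n : holo (fun z => (rho * cexp z) ^+ n) (rho ^+ n).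
Proof. exact: holo_pow (holo_circle rho). Qed.

Lemma mero_inv_circleB rho q : rho != 0 ->
  mero (fun z => (rho * cexp z - q)^-1) /\
  exists2 e : R, 0 < e & forall z, 0 < modc z -> modc z < e -> rho * cexp z - q != 0.
Proof.
move=> rho0; have [<-|rq] := eqVneq rho q.
  by have [_ h] := residue0_exp_pole 0 rho0.
have /holo_inv := holo_add (holo_circle rho) (holo_cst (- q)).
by rewrite subr_eq0 => /(_ rq) [/holo_mero h1 h2].
Qed.

Lemma mero_inv_prod rho l : rho != 0 ->
  mero (fun z => (\prod_(q <- l) (rho * cexp z - q))^-1).
Proof.
move=> rho0; elim: l => [|q l IH].
  apply: mero_eq (holo_mero (holo_cst 1)); exists 1 => // z _ _.
  by rewrite big_nil invr1.
have [h _] := mero_inv_circleB q rho0.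
apply: mero_eq (mero_mul h IH); exists 1 => // z _ _.
by rewrite big_cons invfM.
Qed.

Lemma mero_rfun l a rho : rho != 0 -> mero (rfun l a rho).
Proof.
by move=> rho0; apply: mero_mul (holo_mero (holo_circle_pow rho a.+1)) (mero_inv_prod l rho0).
Qed.

(** x^(a+1)/((x - q) P) = x^a/P + q x^a/((x - q) P). *)
Lemma rsum_cons S q l a : 0 \notin S ->
  rsum S (q :: l) a.+1 = rsum S l a + q * rsum S (q :: l) a.
Proof.
move=> S0; rewrite /rsum mulr_sumr -big_split /=; apply: eq_big_seq => rho rS.
have rho0 : rho != 0 by apply: contraNneq S0 => <-.
have [m1 <-] := mero_residueZ q (mero_rfun (q :: l) a rho0).
have [m2 <-] := mero_residueD (mero_rfun l a rho0) m1.
apply/esym/residue0_eq => //.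
have [_ [e e0 nz]] := mero_inv_circleB q rho0.
exists e => // z z0 ze; have := nz z z0 ze.
rewrite /rfun big_cons !invfM; set x := rho * cexp z; set P := (\prod_(_ <- _) _)^-1.
by move=> xq; rewrite !exprS; field.
Qed.

Lemma rsum_perm S l l' a : perm_eq l l' -> rsum S l a = rsum S l' a.
Proof.
move=> ll; apply: eq_bigr => rho _; congr residue0; apply/funext => z.
by rewrite /rfun (perm_big _ ll).
Qed.

Lemma rsum_nseq S q k : 0 \notin S -> uniq S -> q \in S ->
  rsum S (nseq k q) 0 = (k == 1%N)%:R.
Proof.
move=> S0 uS qS; have q0 : q != 0 by apply: contraNneq S0 => <-.
have rf rho : rfun (nseq k q) 0 rho = fun z => rho * cexp z / (rho * cexp z - q) ^+ k.
  by apply/funext => z; rewrite /rfun expr1 big_nseq iter_mulr_1.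
rewrite /rsum (bigD1_seq q) //= [X in _ + X]big_seq_cond big1 ?addr0.
  by have [<- _] := residue0_exp_pole k q0; rewrite rf.
move=> rho /andP[rS rq].
have rho0 : rho != 0 by apply: contraNneq S0 => <-.
have /holo_inv := holo_add (holo_circle rho) (holo_cst (- q)).
rewrite subr_eq0 => /(_ rq) [/(holo_pow k) h _].
apply: (@residue0_holo _ _ (rho * ((rho - q)^-1) ^+ k)); rewrite rf.
by apply: holo_eq (holo_mul (holo_circle rho) h) => z _; rewrite exprVn.
Qed.

Lemma rsum_split S q q' l : 0 \notin S -> q != q' ->
  rsum S (q :: q' :: l) 0 = (q - q')^-1 * (rsum S (q :: l) 0 - rsum S (q' :: l) 0).
Proof.
move=> S0 qq'; rewrite /rsum -sumrB mulr_sumr; apply: eq_big_seq => rho rS.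
have rho0 : rho != 0 by apply: contraNneq S0 => <-.
have [m1 e1] := mero_residueZ (- 1) (mero_rfun (q' :: l) 0 rho0).
have [m2 e2] := mero_residueD (mero_rfun (q :: l) 0 rho0) m1.
have [m3 e3] := mero_residueZ (q - q')^-1 m2.
rewrite -[_ - residue0 _]/(_ + - _) -[- residue0 _]mulN1r -e1 -e2 -e3.
apply/esym/residue0_eq => //.
have [_ [e e0 nz]] := mero_inv_circleB q rho0.
have [_ [e' e'0 nz']] := mero_inv_circleB q' rho0.
exists (Num.min e e'); first by rewrite lt_min e0.
move=> z z0; rewrite lt_min => /andP[ze ze'].
have := nz z z0 ze; have := nz' z z0 ze'.
rewrite /rfun !big_cons !invfM; set x := rho * cexp z; set P := (\prod_(_ <- _) _)^-1.
move=> xq' xq; rewrite expr1; field.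
by rewrite xq xq' subr_eq0 qq'.
Qed.

(** Induction on the number of factors. If two entries differ, partial fractions give a difference
    of two sums over lists of the same smaller size, which cancel; otherwise [rsum_nseq] applies. *)
Lemma rsum0 S l : 0 \notin S -> uniq S -> {subset l <= S} ->
  rsum S l 0 = (size l == 1%N)%:R.
Proof.
move=> S0 uS; move: {2}(size l) (erefl (size l)) => n; elim: n l => [|n IH] [|q l] //.
  move=> _ _; apply: big1 => rho _; apply: residue0_holo.
  apply: holo_eq (holo_circle rho) => z _.
  by rewrite /rfun big_nil divr1 expr1.
move=> [sl] lS; have qS : q \in S by apply: lS; rewrite mem_head.
have [/all_pred1P e|/allPn [q' q'l /= q'q]] := boolP (all (pred1 q) l).
  by have := rsum_nseq (size l).+1 S0 uS qS; rewrite /= -e.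
have pl := perm_to_rem q'l; set l' := rem q' l in pl.
have l'S : {subset l' <= S}.
  by move=> x /mem_rem xl; apply: lS; rewrite inE xl orbT.
have sl' : (size l').+1 = n by rewrite -sl (perm_size pl).
have -> : rsum S (q :: l) 0 = rsum S (q :: q' :: l') 0.
  by apply: rsum_perm; rewrite perm_cons.
rewrite rsum_split 1?eq_sym // !IH //=; first last.
- by move=> x; rewrite inE => /orP[/eqP ->|/l'S].
- by move=> x; rewrite inE => /orP[/eqP ->|/l'S] //; apply: lS; rewrite inE q'l orbT.
by rewrite subrr mulr0 (perm_size pl) /=.
Qed.

(** This replaces the residue at infinity, which is seen only if the degree gap is exactly one. *)
Lemma rsum_small S l a : 0 \notin S -> uniq S -> {subset l <= S} ->
  (a < size l)%N -> rsum S l a = (a.+1 == size l)%:R.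
Proof.
move=> S0 uS; elim: a l => [|a IH] l lS.
  by rewrite rsum0 // eq_sym.
case: l lS => [//|q l] lS /=; rewrite ltnS => al.
have l'S : {subset l <= S} by move=> x xl; apply: lS; rewrite inE xl orbT.
rewrite rsum_cons // IH // IH //=; last exact: ltnW.
by rewrite !eqSS (ltn_eqF al) mulr0 addr0.
Qed.

Definition cyc N (x : C) : C := \prod_(1 <= j < N.+1) (x ^+ j - 1).

(** Degree of [cyc N], and the power of x gained when every 1 - x^-j is rewritten as (x^j -
    1)/x^j. *)
Definition cycdeg N := (\sum_(1 <= j < N.+1) j)%N.

Lemma cycS N x : cyc N.+1 x = cyc N x * (x ^+ N.+1 - 1).
Proof. by rewrite /cyc big_nat_recr. Qed.

Lemma cycdegS N : cycdeg N.+1 = (cycdeg N + N.+1)%N.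
Proof. by rewrite /cycdeg big_nat_recr. Qed.

Lemma Xn_sub1_roots j : (0 < j)%N -> exists l : seq C,
  [/\ size l = j, forall x, \prod_(q <- l) (x - q) = x ^+ j - 1
    & forall q, (q \in l) = (q ^+ j == 1)].
Proof.
move=> j0; have [l hl] := closed_field_poly_normal ('X^j - 1%:P : {poly C}).
rewrite lead_coefXnsubC // scale1r in hl.
have ev x : \prod_(q <- l) (x - q) = x ^+ j - 1.
  transitivity (('X^j - 1%:P : {poly C}).[x]); last by rewrite !hornerE.
  by rewrite hl horner_prod; apply: eq_bigr => q _; rewrite !hornerE.
exists l; split=> //.
  by have := size_XnsubC (1 : C) j0; rewrite hl size_prod_XsubC => -[].
move=> q; rewrite -root_prod_XsubC -hl /root !hornerE subr_eq0 //.
Qed.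

Lemma cyc_roots N : exists l : seq C,
  [/\ size l = cycdeg N, forall x, \prod_(q <- l) (x - q) = cyc N x
    & forall q, q \in l -> exists2 j, (0 < j <= N)%N & q ^+ j = 1].
Proof.
elim: N => [|N [l [sl pl rl]]].
  exists [::]; split=> //; first by rewrite /cycdeg big_geq.
  by move=> x; rewrite /cyc big_nil big_geq.
have [l' [sl' pl' rl']] := Xn_sub1_roots (ltn0Sn N).
exists (l ++ l'); split.
- by rewrite size_cat sl sl' cycdegS.
- by move=> x; rewrite big_cat /= pl pl' cycS.
move=> q; rewrite mem_cat => /orP[/rl [j /andP[j0 jN] qj]|].
  by exists j; rewrite // j0 leqW.
by rewrite rl' => /eqP qN; exists N.+1; rewrite //= leqnn.
Qed.

Definition cycsum S N a : C :=
  \sum_(rho <- S) residue0 (fun z => (rho * cexp z) ^+ a.+1 / cyc N (rho * cexp z)).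

Lemma mero_cyc N a rho : rho != 0 ->
  mero (fun z => (rho * cexp z) ^+ a.+1 / cyc N (rho * cexp z)) /\
  exists2 e : R, 0 < e & forall z, 0 < modc z -> modc z < e -> cyc N (rho * cexp z) != 0.
Proof.
move=> rho0; have [l [_ pl _]] := cyc_roots N; split.
  apply: mero_eq (mero_rfun l a rho0); exists 1 => // z _ _.
  by rewrite /rfun pl.
have : exists2 e : R, 0 < e & forall z, 0 < modc z -> modc z < e ->
    \prod_(q <- l) (rho * cexp z - q) != 0.
  elim: l {pl} => [|q l [e e0 IH]].
    by exists 1 => // z _ _; rewrite big_nil oner_eq0.
  have [_ [e' e'0 nz']] := mero_inv_circleB q rho0.
  exists (Num.min e e'); first by rewrite lt_min e0.
  move=> z z0; rewrite lt_min => /andP[ze ze'].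
  by rewrite big_cons mulf_neq0 ?IH ?nz'.
by move=> [e e0 h]; exists e => // z z0 ze; rewrite -pl h.
Qed.

(** Write x^(N+1) = 1 + (x^(N+1) - 1): the last factor of the denominator cancels in the second
    term. *)
Lemma cycsum_rec S N a : 0 \notin S ->
  cycsum S N.+1 (a + N.+1) = cycsum S N.+1 a + cycsum S N a.
Proof.
move=> S0; rewrite /cycsum -big_split /=; apply: eq_big_seq => rho rS.
have rho0 : rho != 0 by apply: contraNneq S0 => <-.
have [m1 [e e0 nz]] := mero_cyc N.+1 a rho0; have [m2 _] := mero_cyc N a rho0.
have [m3 <-] := mero_residueD m1 m2.
apply/esym/residue0_eq => //; exists e => // z z0 ze; have := nz z z0 ze.
rewrite !cycS; set x := rho * cexp z; set Q := cyc N x.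
rewrite mulf_eq0 => /norP[Q0 x1]; rewrite -addSn exprD.
set y := x ^+ N.+1 in x1 *; set t := x ^+ a.+1; field.
by rewrite Q0 x1.
Qed.

Lemma cycsum_small S N a : 0 \notin S -> uniq S ->
  (forall q j, (0 < j <= N)%N -> q ^+ j = 1 -> q \in S) ->
  (a < cycdeg N)%N -> cycsum S N a = (a.+1 == cycdeg N)%:R.
Proof.
move=> S0 uS hS aN; have [l [sl pl rl]] := cyc_roots N.
have lS : {subset l <= S} by move=> q /rl [j jN qj]; exact: hS jN qj.
have := rsum_small S0 uS lS; rewrite sl => /(_ a aN) <-.
apply: eq_bigr => rho _; congr residue0; apply/funext => z.
by rewrite /rfun pl.
Qed.

(** The exponent n + [cycdeg N] belongs to p_N(n+1), because the generating differential is
    x^(n+1-1) dx / prod (1 - x^-j). *)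
Lemma cycsum_partition S (p : nat -> nat -> nat) M :
  0 \notin S -> uniq S -> (forall q j, (0 < j <= M)%N -> q ^+ j = 1 -> q \in S) ->
  (forall n, p 0%N n.+1 = 0%N) -> (forall N, p N 0%N = 1%N) ->
  (forall N n, p N.+1 n = p N n + (if N < n then p N.+1 (n - N.+1)%N else 0))%N ->
  forall N n, (N <= M)%N -> cycsum S N (n + cycdeg N) = (p N n.+1)%:R.
Proof.
move=> S0 uS hS p0 pN0 pS; elim=> [|N IHN] n NM.
  rewrite p0; apply: big1 => rho _; apply: residue0_holo.
  apply: holo_eq (holo_circle_pow rho (n + cycdeg 0).+1) => z _.
  by rewrite /cyc big_geq // divr1.
have hS' q j : (0 < j <= N.+1)%N -> q ^+ j = 1 -> q \in S.
  by move=> /andP[j0 jN]; apply: hS; rewrite j0 (leq_trans jN).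
elim/ltn_ind: n => n IHn.
rewrite cycdegS addnA cycsum_rec // pS natrD addrC (IHN _ (ltnW NM)); congr (_ + _).
have [Nn|nN] := leqP N.+1 n.
  have -> : (n + cycdeg N = (n - N.+1) + cycdeg N.+1)%N by rewrite cycdegS; lia.
  rewrite IHn; last by lia.
  by rewrite ltnS ltnW // subSn.
(* For n <= N the shifted exponent lies below the degree: the residue sum is 1 for n = N, matching
   p(N+1, 0) = 1, and 0 for n < N, where the recursion has no second term. *)
rewrite cycsum_small // ?cycdegS; last by lia.
rewrite -addSn addnC eqn_add2l eqSS; move: nN; rewrite ltnS leq_eqVlt => /orP[/eqP ->|nN].
  by rewrite eqxx ltnSn subnn pN0.
by rewrite (ltn_eqF nN) ltnNge nN.
Qed.

End ResidueSums.

(** * Recursion and lower bound for restricted partitions *)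

Section PartitionCount.

Definition is_part (N n : nat) (s : seq nat) :=
  [&& (size s <= N)%N, sorted geq s, all (leq 1) s & sumn s == n].

Lemma mem_le_sumn (s : seq nat) x : x \in s -> (x <= sumn s)%N.
Proof.
elim: s => //= y s IH; rewrite inE => /orP[/eqP ->|/IH h]; first exact: leq_addr.
exact: leq_trans h (leq_addl _ _).
Qed.

(** Leaving the dependent type of bounded sequences, whose parameters vary with N and n, makes
    different counts comparable as lists. *)
Lemma partition_list N n : exists L : seq (seq nat),
  [/\ uniq L, forall s, (s \in L) = is_part N n s & size L = npartitions N n].
Proof.
pose f (s : {bseq N of 'I_n.+1}) := [seq nat_of_ord i | i <- s].
have fI : injective f by move=> s t /(inj_map val_inj) /val_inj.
exists (map f (enum (partitions N n))); split.
- by rewrite map_inj_uniq // enum_uniq.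
- move=> s; apply/mapP/idP => [[t]|].
    rewrite mem_enum inE => /and3P[h1 h2 h3] ->.
    by rewrite /is_part size_map size_bseq h1 h2 h3.
  move=> /and4P[sN h1 h2 h3].
  have sn x : x \in s -> (x <= n)%N by move=> /mem_le_sumn; rewrite (eqP h3).
  have szN : (size [seq (inord x : 'I_n.+1) | x <- s] <= N)%N by rewrite size_map.
  have e : f (Bseq szN) = s.
    by rewrite /f /= -map_comp map_id_in // => x /sn xn /=; rewrite inordK.
  exists (Bseq szN); last by rewrite e.
  rewrite mem_enum inE.
  change [&& sorted geq (f (Bseq szN)), all (leq 1) (f (Bseq szN)) & sumn (f (Bseq szN)) == n].
  by rewrite e h1 h2 h3.
by rewrite size_map -cardE.
Qed.

Lemma npartitions_size N n (L : seq (seq nat)) :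
  uniq L -> (forall s, (s \in L) = is_part N n s) -> npartitions N n = size L.
Proof.
move=> uL hL; have [L' [uL' hL' <-]] := partition_list N n.
by apply/perm_size/uniq_perm => // s; rewrite hL hL'.
Qed.

Lemma npartitions0 N : npartitions N 0 = 1%N.
Proof.
rewrite (@npartitions_size N 0 [:: [::]]) // => s; rewrite inE.
apply/eqP/idP => [->|/and4P[_ _ h /eqP h0]] //.
case: s h h0 => //= x s /andP[x1 _] /eqP; rewrite addn_eq0 => /andP[/eqP x0 _].
by rewrite x0 in x1.
Qed.

Lemma npartitions_0S n : npartitions 0 n.+1 = 0%N.
Proof.
rewrite (@npartitions_size 0 n.+1 [::]) // => s; rewrite in_nil.
by apply/esym/negP => /and4P[]; rewrite leqn0 size_eq0 => /eqP ->.
Qed.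

(* Adding a full first column to a Young diagram, and removing it. *)
Definition add_column (N : nat) (s : seq nat) := map succn s ++ nseq (N - size s) 1%N.
Definition del_column (s : seq nat) := [seq x <- map predn s | (0 < x)%N].

Lemma add_columnK N s : all (leq 1) s -> del_column (add_column N s) = s.
Proof.
move=> s1; rewrite /del_column /add_column map_cat filter_cat -map_comp map_id_in //.
rewrite (all_filterP s1) map_nseq -[RHS]cats0; congr (_ ++ _).
by elim: (N - size s)%N.
Qed.

Lemma geq_trans : transitive geq.
Proof. by move=> x y z /= xy zx; exact: leq_trans zx xy. Qed.

(** From the first part equal to 1 on, all parts are 1; they disappear in [del_column] and return as
    padding. *)
Lemma del_columnK s : sorted geq s -> all (leq 1) s -> add_column (size s) (del_column s) = s.
Proof.
elim: s => //= x s IH xs /andP[x1 s1].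
have [x2|x_le1] := ltnP 1 x.
  have x0 : (0 < x.-1)%N by case: (x) x2.
  rewrite /add_column /del_column /= x0 /= subSS prednK //; congr (_ :: _).
  by apply: IH => //; exact: path_sorted xs.
have xE : x = 1%N by apply/eqP; rewrite eqn_leq x_le1.
have sE : s = nseq (size s) 1%N.
  apply/all_pred1P/allP => y ys /=; rewrite eqn_leq (allP s1 y ys) andbT.
  have /allP := order_path_min geq_trans xs.
  by move=> /(_ y ys) /= yx; rewrite -xE.
have e : [seq y <- map predn s | (0 < y)%N] = [::].
  by rewrite sE map_nseq; elim: (size s).
by rewrite /add_column /del_column xE /= e /= -sE.
Qed.

Lemma size_add_column N s : (size s <= N)%N -> size (add_column N s) = N.
Proof. by move=> sN; rewrite size_cat size_map size_nseq subnKC. Qed.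

Lemma sumn_add_column N s : (size s <= N)%N -> sumn (add_column N s) = (sumn s + N)%N.
Proof.
move=> sN; rewrite sumn_cat sumn_nseq mul1n.
have -> : sumn (map succn s) = (sumn s + size s)%N.
  by elim: s {sN} => //= x s ->; lia.
by rewrite -addnA subnKC.
Qed.

Lemma is_part_add_column N n s : is_part N n s -> is_part N (n + N)%N (add_column N s).
Proof.
move=> /and4P[sN ss s1 /eqP sn]; rewrite /is_part size_add_column //.
rewrite leqnn sumn_add_column // sn eqxx.
rewrite andbT /=; apply/andP; split; last first.
  rewrite all_cat; apply/andP; split; last by rewrite all_nseq orbT.
  by apply/allP => y /mapP [x _ ->].
rewrite (sorted_pairwise geq_trans) pairwise_cat; apply/and3P; split.
- apply/allrelP => x y /mapP [x' _ ->]; by rewrite mem_nseq => /andP[_ /eqP ->].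
- rewrite -(sorted_pairwise geq_trans) sorted_map.
  by apply: sub_sorted ss => x y /=; rewrite ltnS.
by rewrite -(sorted_pairwise geq_trans); elim: (N - size s)%N => //= -[|k].
Qed.

Lemma is_part_del_column n s : is_part (size s) n s ->
  is_part (size s) (n - size s)%N (del_column s).
Proof.
move=> /and4P[_ ss s1 /eqP sn].
have sz : (size (del_column s) <= size s)%N.
  by rewrite size_filter (leq_trans (count_size _ _)) // size_map.
rewrite /is_part sz /=; apply/and3P; split.
- apply: (sorted_filter geq_trans).
  by rewrite sorted_map; apply: sub_sorted ss => x y /= yx; lia.
- exact: filter_all.
by rewrite -sn -{2}(del_columnK ss s1) sumn_add_column // addnK.
Qed.

(** Either there are at most N parts, or exactly N + 1, and then removing the first column leaves
    any partition of n - (N + 1) into at most N + 1 parts. *)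
Lemma npartitionsS N n : npartitions N.+1 n =
  (npartitions N n + (if (N < n)%N then npartitions N.+1 (n - N.+1) else 0))%N.
Proof.
have [L1 [u1 m1 <-]] := partition_list N n.
have [L2 [u2 m2 s2]] := partition_list N.+1 (n - N.+1).
have sz s : is_part N n s -> (size s <= N)%N by case/and4P.
have big s : is_part N.+1 n s -> ~~ (size s <= N)%N -> size s = N.+1 /\ (N < n)%N.
  move=> /and4P[h1 _ h2 /eqP h3]; rewrite -ltnNge => h4.
  have -> : size s = N.+1 by apply/eqP; rewrite eqn_leq h1.
  split=> //; rewrite -h3; apply: leq_trans h4 _.
  by elim: s h2 {h1 h3} => //= x s IH /andP[x1 /IH h]; rewrite -add1n leq_add.
have [Nn|nN] := ltnP N n.
  rewrite -s2 -(size_map (add_column N.+1) L2) -size_cat; apply: npartitions_size.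
    rewrite cat_uniq u1 map_inj_in_uniq ?u2 ?andbT; last first.
      move=> s t; rewrite !m2 => /and4P[_ _ hs _] /and4P[_ _ ht _] e.
      by rewrite -(add_columnK N.+1 hs) e add_columnK.
    apply/hasPn => s /mapP [t]; rewrite m2 => /and4P[h _ _ _] -> /=; rewrite m1 /is_part.
    by rewrite size_add_column // ltnn.
  move=> s; rewrite mem_cat m1; apply/orP/idP.
    case=> [/and4P[h1 h2 h3 h4]|/mapP [t]]; first by rewrite /is_part h2 h3 h4 leqW.
    by rewrite m2 => /is_part_add_column; rewrite subnK // => h ->.
  move=> hs; case: (boolP (size s <= N)%N) => sN.
    by left; move: hs; rewrite /is_part sN => /and4P[_ -> -> ->].
  have [sE _] := big s hs sN; right; apply/mapP.
  have hs' := hs; rewrite -sE in hs'.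
  exists (del_column s); first by rewrite m2 -sE is_part_del_column.
  by rewrite -sE del_columnK //; case/and4P: hs.
rewrite addn0; apply: npartitions_size => // s; rewrite m1.
apply/idP/idP => [/and4P[h1 h2 h3 h4]|hs]; first by rewrite /is_part h2 h3 h4 leqW.
case: (boolP (size s <= N)%N) => sN.
  by move: hs; rewrite /is_part sN => /and4P[_ -> -> ->].
by have [_] := big s hs sN; rewrite ltnNge nN.
Qed.

Lemma npartitions_leN N N' n : (N <= N')%N -> (npartitions N n <= npartitions N' n)%N.
Proof.
move=> /subnK <-; elim: (N' - N)%N => // k IH.
by rewrite addSn npartitionsS; apply: leq_trans IH (leq_addr _ _).
Qed.

Lemma expn_le_subn k n d : (d <= n)%N ->
  (n ^ k.+1 <= (n - d) ^ k.+1 + k.+1 * d * n ^ k)%N.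
Proof.
move=> dn; elim: k => [|k IH]; first by rewrite !expn1 expn0; lia.
have h : ((n - d) ^ k.+1 <= n ^ k.+1)%N by rewrite leq_exp2r // leq_subr.
have e : (n * (n - d) ^ k.+1 = (n - d) ^ k.+2 + d * (n - d) ^ k.+1)%N.
  by rewrite [in RHS]expnS -mulnDl subnK.
rewrite expnS; apply: leq_trans (leq_mul (leqnn n) IH) _.
rewrite mulnDr e; rewrite -[in X in (_ + n * X <= _)%N]mulnA.
have -> : (n * (k.+1 * (d * n ^ k)) = k.+1 * d * n ^ k.+1)%N by rewrite expnS; ring.
have := leq_mul (leqnn d) h; lia.
Qed.

(** In the step from M, the term with fewer parts contributes (M+2)(M+1) n^M, exactly what
    [expn_le_subn] loses when n drops by M + 2. *)
Lemma npartitions_ge M n : (n ^ M <= npartitions M.+1 n * (M.+1`! * M`!))%N.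
Proof.
elim: M n => [|M IH].
  elim=> [|n IHn]; first by rewrite npartitions0.
  rewrite npartitionsS /= subn1 /= mulnDl expn0.
  by rewrite expn0 in IHn; apply: leq_trans IHn (leq_addl _ _).
elim/ltn_ind => n IHn; rewrite npartitionsS mulnDl.
have h : ((M.+2 * M.+1) * n ^ M <= npartitions M.+1 n * (M.+2`! * M.+1`!))%N.
  have -> : (npartitions M.+1 n * (M.+2`! * M.+1`!)
      = (M.+2 * M.+1) * (npartitions M.+1 n * (M.+1`! * M`!)))%N.
    by rewrite (factS M.+1) [in X in (_ * (_ * X))%N]factS; ring.
  by rewrite leq_mul.
have [Mn|nM] := ltnP M.+1 n.
  have h2 := IHn (n - M.+2)%N _.
  have := expn_le_subn M Mn; have := h2 _; rewrite ltn_subrL; lia.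
(* For n <= M + 1 the term with fewer parts suffices, since n <= (M+2)(M+1). *)
rewrite mul0n addn0; apply: leq_trans h; rewrite expnS leq_mul //.
by apply: leq_trans nM _; rewrite leq_pmull.
Qed.

End PartitionCount.

(** * Lower bounds for |1 - rho^j| and for products of such gaps *)

Section RootsOfUnity.
Variable R : realType.
Local Notation C := (R[i]).
Implicit Types (rho : C).

Lemma modc_root rho k : (0 < k)%N -> rho ^+ k = 1 -> modc rho = 1.
Proof.
move=> k0 /(congr1 (@modc R)); rewrite modcX modc1 => h.
by apply/eqP; rewrite -(@pexpr_eq1 _ _ k) ?modc_ge0 // h.
Qed.

Lemma modc_1subX rho j : modc rho = 1 -> modc (1 - rho ^+ j) <= j%:R * modc (1 - rho).
Proof.
move=> m1; have -> : 1 - rho ^+ j = (\sum_(i < j) rho ^+ i) * (1 - rho).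
  by rewrite -[LHS]opprB subrX1; ring.
rewrite modcM ler_wpM2r ?modc_ge0 //; apply: le_trans (modc_sum _ _ _) _.
under eq_bigr do rewrite modcX m1 expr1n.
by rewrite sumr_const card_ord.
Qed.

(** The powers of rho sum to 0, so k is the sum of the k numbers 1 - rho^i, each of modulus at most
    k |1 - rho|. *)
Lemma modc_1sub_root rho k : (0 < k)%N -> rho ^+ k = 1 -> rho != 1 ->
  1 <= k%:R * modc (1 - rho).
Proof.
move=> k0 rk r1; have m1 := modc_root k0 rk.
have s0 : \sum_(i < k) rho ^+ i = 0.
  have := subrX1 rho k; rewrite rk subrr => /esym/eqP.
  by rewrite mulf_eq0 subr_eq0 (negPf r1) => /eqP.
have kE : (k%:R : C) = \sum_(i < k) (1 - rho ^+ i).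
  by rewrite sumrB s0 subr0 sumr_const card_ord.
have k0' : 0 < k%:R :> R by rewrite ltr0n.
rewrite -(ler_pM2l k0') mulr1 -{1}modc_nat kE.
apply: le_trans (modc_sum _ _ _) _.
apply: (@le_trans _ _ (\sum_(i < k) (k%:R * modc (1 - rho)))).
  apply: ler_sum => i _; apply: le_trans (modc_1subX i m1) _.
  by rewrite ler_wpM2r ?modc_ge0 // ler_nat ltnW.
by rewrite sumr_const card_ord [leRHS]mulr_natl.
Qed.

(** (X^k - 1)/(X - 1) evaluated at 1 in two ways. *)
Lemma prod_1sub_prim k rho : (0 < k)%N -> k.-primitive_root rho ->
  \prod_(1 <= j < k) (1 - rho ^+ j) = k%:R.
Proof.
move=> k0 prim; have := factor_Xn_sub_1 prim.
rewrite big_ltn // expr0 subrX1 polyC1 => /(mulfI _) e.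
have {}e : \prod_(1 <= i < k) ('X - (rho ^+ i)%:P) = \sum_(i < k) 'X^i :> {poly C}.
  by apply: e; rewrite -polyC1 polyXsubC_eq0.
have := congr1 (horner^~ 1) e; rewrite horner_prod horner_sum.
under eq_bigr do rewrite hornerXsubC.
move=> ->; under eq_bigr do rewrite hornerXn expr1n.
by rewrite sumr_const card_ord.
Qed.

(** The value 1 at multiples of k takes the vanishing factors, which form the pole, out of the
    product. *)
Definition gapw k rho j : R := if (k %| j)%N then 1 else modc (1 - rho ^+ j).

Definition gapprod k rho N : R := \prod_(1 <= j < N.+1) gapw k rho j.

Lemma gapw_gt0 k rho j : k.-primitive_root rho -> 0 < gapw k rho j.
Proof.
move=> prim; rewrite /gapw (prim_order_dvd prim); case: ifP => // /negbT h.
by rewrite modc_gt0 subr_eq0 eq_sym.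
Qed.

Lemma gapw_le2 k rho j : (0 < k)%N -> k.-primitive_root rho -> gapw k rho j <= 2.
Proof.
move=> k0 prim; have m1 := modc_root k0 (prim_expr_order prim).
rewrite /gapw; case: ifP => _; first by rewrite ler1n.
by apply: le_trans (modcB _ _) _; rewrite modc1 modcX m1 expr1n.
Qed.

Lemma gapprod_period k rho : (0 < k)%N -> k.-primitive_root rho -> gapprod k rho k = k%:R.
Proof.
move=> k0 prim; rewrite /gapprod big_nat_recr //= {2}/gapw dvdnn mulr1.
rewrite -(modc_nat R) -(prod_1sub_prim k0 prim) modc_prod.
apply: eq_big_nat => j /andP[j0 jk]; rewrite /gapw gtnNdvd //.
Qed.

Lemma gapprod_add k rho N : (0 < k)%N -> k.-primitive_root rho ->
  gapprod k rho (N + k) = k%:R * gapprod k rho N.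
Proof.
move=> k0 prim; rewrite -(gapprod_period k0 prim) /gapprod.
rewrite (big_cat_nat (n := k.+1)) //=; last by rewrite ltnS leq_addl.
congr (_ * _); rewrite -{1}add1n -addSn big_addn addnK.
apply: eq_bigr => j _; rewrite /gapw dvdn_addl // exprD.
by rewrite (prim_expr_order prim) mulr1.
Qed.

(** Full periods contribute k >= 1 and are stripped off. An incomplete period is the full product k
    divided by fewer than or exactly k missing factors, each at most 2. *)
Lemma gapprod_ge k rho N : (0 < k)%N -> k.-primitive_root rho ->
  1 <= 2 ^+ k * gapprod k rho N.
Proof.
move=> k0 prim; elim/ltn_ind: N => N IH.
have gp M : 0 < gapprod k rho M by apply: prodr_gt0 => j _; exact: gapw_gt0.
have [kN|Nk] := leqP k N.
  rewrite -(subnK kN) gapprod_add // mulrCA.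
  have h := IH (N - k)%N; rewrite ltn_subrL k0 (leq_trans k0 kN) in h.
  by apply: le_trans (h isT) _; rewrite ler_peMl ?ler1n // mulr_ge0 ?exprn_ge0 ?(ltW (gp _)).
have e : gapprod k rho k = gapprod k rho N * \prod_(N.+1 <= j < k.+1) gapw k rho j.
  by rewrite /gapprod (big_cat_nat (n := N.+1)) //= ltnS ltnW.
have h2 : \prod_(N.+1 <= j < k.+1) gapw k rho j <= 2 ^+ (k - N).
  rewrite -subSS -prodr_const_nat; apply: ler_prod => j _.
  by rewrite gapw_le2 // ltW // gapw_gt0.
apply: (@le_trans _ _ k%:R); first by rewrite ler1n.
rewrite -(gapprod_period k0 prim) e mulrC ler_wpM2r ?(ltW (gp _)) //.
by apply: le_trans h2 _; rewrite ler_eXn2l ?ltr1n // leq_subr.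
Qed.

End RootsOfUnity.

(** * Norm bounds for the inverse of a single factor *)

Section WaveSummandBound.
Variable R : realType.
Local Notation C := (R[i]).
Implicit Types (rho alpha : C) (r x : R).

Lemma expn2_le_fact i : (2 ^ i <= i.+1`!)%N.
Proof. by elim: i => // i IH; rewrite expnS factS leq_mul. Qed.

Lemma psum_fact_le2 (u : nat -> R) x n : 0 <= x <= 1 ->
  (forall i, u i <= (i.+1`!%:R)^-1) -> psum u x n <= 2.
Proof.
move=> /andP[x0 x1] hu.
have h : psum u x n <= 2 - 2 / 2 ^+ n.
  elim: n => [|n IH]; first by rewrite /psum big_ord0 expr0 divr1 subrr.
  rewrite /psum big_ord_recr /=; apply: le_trans (lerD IH (lexx _)) _.
  have : u n * x ^+ n <= (2 ^+ n)^-1.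
    apply: (@le_trans _ _ ((n.+1`!%:R)^-1 * 1)).
      apply: (@le_trans _ _ ((n.+1`!%:R)^-1 * x ^+ n)).
        by rewrite ler_wpM2r ?exprn_ge0.
      by rewrite ler_wpM2l ?invr_ge0 // exprn_ile1.
    by rewrite mulr1 lef_pV2 ?posrE ?exprn_gt0 ?ltr0n ?fact_gt0 // -natrX ler_nat expn2_le_fact.
  have -> : 2 / 2 ^+ n.+1 = (2 ^+ n)^-1 :> R by rewrite exprS; field; rewrite expf_neq0.
  lra.
apply: le_trans h _; by rewrite gerBl divr_ge0 // exprn_ge0.
Qed.

(** Around the constant term 1 - alpha the remaining series has norm at most 2 j r, because 1/(i+1)!
    <= 2^-i and j r <= 1; [lexp_inv] does the rest. *)
Lemma lexp_factor alpha j r theta : (0 < j)%N -> 0 < r -> modc alpha = 1 ->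
  j%:R * r <= 1 -> theta < 1 -> alpha != 1 ->
  2 * (j%:R * r) <= theta * modc (1 - alpha) ->
  exists b, lexp r ((modc (1 - alpha))^-1 / (1 - theta)) 0 b
    (fun z => (1 - alpha * cexp (- (j%:R * z)))^-1).
Proof.
move=> j0 r0 m1 jr t1 a1 ht.
have h := lexp_add r0 (lexp_cst (1 : C) r0) (lexp_scale (- alpha) r0 (lexp_cexp (- j%:R : C) r0)).
have e0 : cst_seq 1 0%N + - alpha * exp_seq (- j%:R : C) 0 = 1 - alpha.
  by rewrite /exp_seq expr0 divr1 mulr1.
have [] := lexp_inv r0 h _ t1 _; rewrite e0.
- by rewrite subr_eq0 eq_sym.
- move=> n; apply: le_trans ht.
  have -> : r * psum (fun i => modc (cst_seq 1 i.+1 + - alpha * exp_seq (- j%:R : C) i.+1)) r n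
     = (j%:R * r) * psum (fun i => (i.+1`!%:R)^-1) (j%:R * r) n.
    rewrite /psum !mulr_sumr; apply: eq_bigr => i _; rewrite add0r modcM modcN m1 mul1r.
    by rewrite modc_exp_seq /exp_seq modcN modc_nat exprMn exprS; ring.
  rewrite mulrC ler_wpM2r ?mulr_ge0 ?(ltW r0) //.
  by apply: psum_fact_le2 => //; rewrite jr mulr_ge0 // ltW.
move=> h1 _; exists (inv_coef (fun i => cst_seq 1 i + - alpha * exp_seq (- j%:R : C) i)).
by apply: lexp_eq h1 => z _ _; rewrite !mulNr.
Qed.

(** The zero at 0 is divided out first: (1 - e^(-jz))/z has constant term j, and for 4 j r <= 1 the
    rest has norm at most j/2. *)
Lemma lexp_pole_factor j r : (0 < j)%N -> 0 < r -> 4 * (j%:R * r) <= 1 ->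
  exists b : nat -> C, lexp r (2 / j%:R) 1 b (fun z => (1 - cexp (- (j%:R * z)))^-1).
Proof.
move=> j0 r0 jr.
have h := lexp_add r0 (lexp_cst (1 : C) r0) (lexp_scale (- 1) r0 (lexp_cexp (- j%:R : C) r0)).
have {h} := lexp_divz r0 _ h.
rewrite /exp_seq expr0 divr1 mulr1 subrr => /(_ erefl) h.
pose c i : C := cst_seq 1 i.+1 + -1 * exp_seq (- j%:R) i.+1.
have jr0 : 0 <= j%:R * r by rewrite mulr_ge0 // ltW.
have j0' : 0 < j%:R :> R by rewrite ltr0n.
have c0 : c 0%N = j%:R by rewrite /c /exp_seq expr1 divr1; ring.
have half1 : (1 / 2 : R) < 1 by lra.
have [] := @lexp_inv R r _ (1 / 2) c _ r0 h _ half1 _.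
- by rewrite c0 pnatr_eq0 -lt0n.
- move=> n; rewrite c0 modc_nat.
  have -> : r * psum (fun i => modc (c i.+1)) r n
     = j%:R * (j%:R * r) * psum (fun i => (i.+2`!%:R)^-1) (j%:R * r) n.
    rewrite /psum !mulr_sumr; apply: eq_bigr => i _; rewrite /c add0r modcM modcN modc1 mul1r.
    by rewrite modc_exp_seq /exp_seq modcN modc_nat exprMn !exprS; ring.
  have : psum (fun i => (i.+2`!%:R)^-1) (j%:R * r) n <= 2.
    apply: psum_fact_le2 => [|i]; first by rewrite jr0; lra.
    by rewrite lef_pV2 ?posrE ?ltr0n ?fact_gt0 // ler_nat [in leqRHS]factS leq_pmull.
  set p := psum _ _ _ => hp.
  have : j%:R * r * p <= 1 / 2 by nra.
  by move=> hle; rewrite -[leLHS]mulrA [leRHS]mulrC (ler_pM2l j0').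
rewrite c0 modc_nat => [[h1 h2] _]; exists (inv_coef c); split.
  have -> : 2 / j%:R = j%:R^-1 / (1 - 1 / 2) :> R by field; lra.
  exact: h1.
move=> z z0 zr; have := h2 z z0 zr; rewrite expr0 mulr1 expr1.
by rewrite invfM invrK mulN1r mulNr.
Qed.

End WaveSummandBound.

(** * Norm bound for a summand of a wave and its residue for k > 100 *)

Section WaveSummand.
Variable R : realType.
Local Notation C := (R[i]).
Implicit Types (rho : C) (r x : R).

Definition wave_summand (N n : nat) rho (z : C) : C :=
  rho ^ n%:Z * cexp (n%:~R * z)
    / \prod_(1 <= j < N.+1) (1 - rho ^- j * cexp (- (j%:R * z))).

Definition multw k j : R := if (k %| j)%N then 2 / j%:R else 1.

Lemma multw_prod k M : (0 < k)%N ->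
  \prod_(1 <= j < M.+1) multw k j = (2 / k%:R) ^+ (M %/ k) / (M %/ k)`!%:R.
Proof.
move=> k0; elim: M => [|M IH]; first by rewrite big_geq // div0n expr0 divr1.
rewrite big_nat_recr //= IH divnS // /multw; case: (boolP (k %| M.+1)%N) => kM /=; last first.
  by rewrite mulr1 add0n.
have -> : M.+1%:R = k%:R * (M %/ k).+1%:R :> R.
  by rewrite -natrM -{1}(divnK kM) divnS // kM add1n mulnC.
rewrite add1n exprS factS natrM.
have kn : k%:R != 0 :> R by rewrite pnatr_eq0 -lt0n.
have fn : (M %/ k)`!%:R != 0 :> R by rewrite pnatr_eq0 -lt0n fact_gt0.
have un : (M %/ k).+1%:R != 0 :> R by rewrite pnatr_eq0.
by move: kn fn un; move: (M %/ k).+1%:R => u kn fn un; field; rewrite kn fn un.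
Qed.

(** If k does not divide j, then 2 j r <= 1/(50 k) <= |1 - rho^-j| / 50, so theta = 1/50 and the
    inverse costs 50/49 over the gap. Multiples of k cost [multw] and account for the pole order. *)
Lemma lexp_inv_wave_den k N r rho M : (0 < k)%N -> k.-primitive_root rho -> 0 < r ->
  100 * (k%:R * (N%:R * r)) <= 1 -> (M <= N)%N ->
  exists B b, lexp r B (M %/ k) b
    (fun z : C => (\prod_(1 <= j < M.+1) (1 - rho ^- j * cexp (- (j%:R * z))))^-1) /\
    B <= (50 / 49) ^+ M * (gapprod k rho M)^-1 * \prod_(1 <= j < M.+1) multw k j.
Proof.
move=> k0 prim r0 kNr; elim: M => [|M IH] MN.
  exists (modc (1 : C)), (cst_seq 1); rewrite div0n; split; last first.
    by rewrite /gapprod !big_geq // expr0 invr1 !mulr1 modc1.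
  by apply: lexp_eq (lexp_cst 1 r0) => z _ _; rewrite big_geq // invr1.
have [B [b [hb hB]]] := IH (ltnW MN).
have k0' : 0 < k%:R :> R by rewrite ltr0n.
have k1 : 1 <= k%:R :> R by rewrite ler1n.
have jN : M.+1%:R * r <= N%:R * r by rewrite ler_wpM2r ?ler_nat // ltW.
have j0 : 0 < M.+1%:R * r by rewrite mulr_gt0 // ltr0n.
have kjr : 100 * (k%:R * (M.+1%:R * r)) <= 1.
  by apply: le_trans kNr; rewrite ler_pM2l // ler_pM2l.
have jr : 100 * (M.+1%:R * r) <= 1 by nra.
have kr := prim_expr_order prim.
have mr := modc_root k0 kr.
have rho0 : rho != 0 by rewrite -modc_eq0 mr oner_eq0.
have mj : modc (rho ^- M.+1) = 1 by rewrite modcV modcX mr expr1n invr1.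
have mE : modc (1 - rho ^- M.+1) = modc (1 - rho ^+ M.+1).
  have -> : 1 - rho ^- M.+1 = - (rho ^- M.+1) * (1 - rho ^+ M.+1).
    by field; rewrite expf_neq0.
  by rewrite modcM modcN mj mul1r.
have B0 := wbound_ge0 (proj1 hb).
have gp : 0 < gapprod k rho M by apply: prodr_gt0 => j _; exact: gapw_gt0.
have mp : 0 <= \prod_(1 <= j < M.+1) multw k j.
  by apply: prodr_ge0 => j _; rewrite /multw; case: ifP => // _; rewrite divr_ge0.
suff [B' [b' [hb' hB']]] : exists B' b', lexp r B' (k %| M.+1)%N b'
    (fun z : C => (1 - rho ^- M.+1 * cexp (- (M.+1%:R * z)))^-1) /\
    B' <= 50 / 49 * (gapw k rho M.+1)^-1 * multw k M.+1.
  exists (B * B'), (conv b b'); split; last first.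
    rewrite /gapprod !(big_nat_recr M.+1) //= -/(gapprod k rho M) exprSr invfM.
    apply: (le_trans (ler_pM B0 (wbound_ge0 (proj1 hb')) hB hB')).
    by rewrite le_eqVlt; apply/orP; left; apply/eqP; ring.
  rewrite divnS // addnC; apply: lexp_eq (lexp_mul r0 hb hb') => z _ _.
  by rewrite [in RHS](big_nat_recr M.+1) //= invfM.
case: (boolP (k %| M.+1)%N) => kM /=.
  have [//||b' hb'] := @lexp_pole_factor R M.+1 r _ r0 _; first lra.
  exists (2 / M.+1%:R), b'; split.
    apply: lexp_eq hb' => z _ _.
    by move: kM; rewrite (prim_order_dvd prim) => /eqP ->; rewrite invr1 mul1r.
  rewrite /gapw /multw kM invr1 mulr1 -[leLHS]mul1r ler_wpM2r ?divr_ge0 //; lra.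
have a1 : rho ^- M.+1 != 1.
  by apply: contra kM; rewrite (prim_order_dvd prim) invr_eq1.
have h1 : 1 <= k%:R * modc (1 - rho ^- M.+1).
  apply: modc_1sub_root => //; by rewrite exprVn -exprM mulnC exprM kr expr1n invr1.
have t1 : (1 / 50 : R) < 1 by lra.
have ht : 2 * (M.+1%:R * r) <= 1 / 50 * modc (1 - rho ^- M.+1).
  by rewrite -(ler_pM2l k0'); lra.
have jr1 : M.+1%:R * r <= 1 by lra.
have [b' hb'] := lexp_factor (ltn0Sn M) r0 mj jr1 t1 a1 ht.
exists ((modc (1 - rho ^- M.+1))^-1 / (1 - 1 / 50)), b'; split=> //.
rewrite /gapw /multw (negPf kM) mulr1 mE mulrC le_eqVlt; apply/orP; left; apply/eqP.
by congr (_ * _); field.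
Qed.

Lemma lexp_wave_summand k N n r rho : (0 < k)%N -> k.-primitive_root rho -> 0 < r ->
  100 * (k%:R * (N%:R * r)) <= 1 ->
  exists B b, lexp r B (N %/ k) b (wave_summand N n rho) /\
    B <= expR (n%:R * r) * ((50 / 49) ^+ N * (gapprod k rho N)^-1
       * ((2 / k%:R) ^+ (N %/ k) / (N %/ k)`!%:R)).
Proof.
move=> k0 prim r0 kNr.
have [B [b [hb hB]]] := lexp_inv_wave_den k0 prim r0 kNr (leqnn N).
have mr := modc_root k0 (prim_expr_order prim).
exists (modc (rho ^+ n) * (expR (modc (n%:R : C) * r) * B)),
  (fun i => rho ^+ n * conv (exp_seq n%:R) b i); split; last first.
  rewrite modcX mr expr1n mul1r modc_nat -multw_prod //.
  by rewrite ler_wpM2l // expR_ge0.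
have := lexp_scale (rho ^+ n) r0 (lexp_mul r0 (lexp_cexp n%:R r0) hb).
rewrite add0n; apply: lexp_eq => z _ _.
by rewrite /wave_summand -pmulrn -exprnP mulrA.
Qed.

Lemma expR_ge_sum4 x : 0 <= x -> 1 + x + x ^+ 2 / 2 + x ^+ 3 / 6 <= expR x.
Proof.
move=> x0; apply: le_trans (psum_exp_seq_le 4 x0).
rewrite /psum !big_ord_recr big_ord0 /= /exp_seq !expr1n !mulr1 add0r expr0 expr1.
by rewrite le_eqVlt; apply/orP; left; apply/eqP; rewrite !factS fact0; field.
Qed.

Lemma pow_fact_le_expR x s : 0 <= x -> x ^+ s / s`!%:R <= expR x.
Proof.
move=> x0; apply: le_trans (psum_exp_seq_le s.+1 x0).
rewrite /psum big_ord_recr /= expr1n mulr1 lerDr sumr_ge0 // => i _.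
by rewrite expr1n mulr1 divr_ge0 // exprn_ge0.
Qed.

Lemma pow_le_expR (a b : R) m : 0 <= a -> a <= expR b -> a ^+ m <= expR (b * m%:R).
Proof. by move=> a0 ab; rewrite expRM_natr lerXn2r // nnegrE // expR_ge0. Qed.

(* 200 k = 200 * 101 * (k / 101) <= e^10 e^10 e^(k/101 - 1), and the exponent
   is at most 20 k / 101 once k >= 101. *)
Lemma le_expR_20_101 (k : R) : 101 <= k -> 200 * k <= expR (20 / 101 * k).
Proof.
move=> k101.
have h1 : k / 101 <= expR (k / 101 - 1).
  by apply: le_trans (expR_ge1Dx _); lra.
have h2 : 200 <= expR (10 : R).
  have e2 : 2 <= expR (1 : R) by apply: le_trans (expR_ge1Dx _); lra.
  have := pow_le_expR 8 (ler0n R 2) e2; rewrite mul1r => h8.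
  have h108 : expR (8 : R) <= expR 10 by rewrite ler_expR; lra.
  have p8 : (2 : R) ^+ 8 = 256 by rewrite -natrX.
  lra.
apply: (@le_trans _ _ (expR 10 * expR 10 * expR (k / 101 - 1))); last first.
  by rewrite -!expRD ler_expR; lra.
have k0 : 0 <= k / 101 by lra.
have x0 := expR_ge0 (k / 101 - 1).
have -> : 200 * k = 200 * 101 * (k / 101) by field.
have h3 : 200 * 101 <= expR 10 * expR (10 : R) by nra.
have h4 : 0 <= 200 * 101 :> R by rewrite mulr_ge0 // ler0n.
exact: ler_pM.
Qed.

(** The norm bound at r = 1/(100 k N), with 2^k for the inverse gap product, times r^(1-s) for pole
    order s = [N %/ k]. The exponents are 1/200 from e^(n r), 1/49 from (50/49)^N, and 7/10 for the
    rest. *)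
Lemma tail_exponent k N n : (101 <= k <= N)%N -> (n%:R : R) <= 29 / 10 * N%:R ^+ 2 ->
  expR (n%:R * (100 * (k%:R * N%:R))^-1 : R) * ((50 / 49) ^+ N * 2 ^+ k
     * ((2 / k%:R) ^+ (N %/ k) / (N %/ k)`!%:R)) * (100 * (k%:R * N%:R)) ^+ (N %/ k).-1
  <= 2 * expR (73 / 100 * N%:R).
Proof.
move=> /andP[k101 kN] hn.
have k0 : (0 < k)%N by apply: leq_trans k101.
have N0 : (0 < N)%N by apply: leq_trans kN.
have kR : 101 <= k%:R :> R by rewrite ler_nat.
have kNR : k%:R <= N%:R :> R by rewrite ler_nat.
have k0R : 0 < k%:R :> R by rewrite ltr0n.
have N0R : 0 < N%:R :> R by rewrite ltr0n.
have e1 : expR (n%:R * (100 * (k%:R * N%:R))^-1) <= expR (1 / 200 * N%:R) :> R.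
  rewrite ler_expR ler_pdivrMr ?mulr_gt0 //; apply: le_trans hn _; nra.
have e2 : (50 / 49) ^+ N <= expR (1 / 49 * N%:R) :> R.
  by apply: pow_le_expR; [lra | apply: le_trans (expR_ge1Dx _); lra].
(* The cubic Taylor sum of e^(7/10) is about 2.002, just enough. *)
have e3 : 2 ^+ k <= expR (7 / 10 * k%:R) :> R.
  by apply: pow_le_expR; [lra | apply: le_trans (expR_ge_sum4 _); lra].
set s := (N %/ k)%N.
have s1 : (1 <= s)%N by rewrite divn_gt0.
have sk : k%:R * s%:R <= N%:R :> R by rewrite -natrM ler_nat mulnC leq_trunc_div.
have [x0 y0] : 0 <= (50 / 49 : R) ^+ N /\ 0 <= (2 : R) ^+ k by split; apply: exprn_ge0; lra.
have D0 : 0 < 100 * (k%:R * N%:R) :> R by rewrite !mulr_gt0.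
have z0 : 0 <= (2 / k%:R) ^+ s / s`!%:R * (100 * (k%:R * N%:R)) ^+ s.-1 :> R.
  by rewrite mulr_ge0 ?divr_ge0 ?exprn_ge0 ?divr_ge0 // ltW.
have assoc (a b c d e : R) : a * (b * c * d) * e = a * (b * (c * (d * e))) by ring.
rewrite assoc.
suff : 2 ^+ k * ((2 / k%:R) ^+ s / s`!%:R * (100 * (k%:R * N%:R)) ^+ s.-1)
    <= 2 * expR (7 / 10 * N%:R) :> R.
  move=> h.
  have -> : (73 / 100 * N%:R : R) = 1 / 200 * N%:R + (1 / 49 * N%:R + 7 / 10 * N%:R)
     + (73 / 100 - 1 / 200 - 1 / 49 - 7 / 10) * N%:R by field.
  apply: (@le_trans _ _ (2 * expR (1 / 200 * N%:R + (1 / 49 * N%:R + 7 / 10 * N%:R)))).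
    have yz := mulr_ge0 y0 z0.
    have h5 := ler_pM x0 yz e2 h.
    apply: le_trans (ler_pM (expR_ge0 _) (mulr_ge0 x0 yz) e1 h5) _.
    by rewrite !expRD le_eqVlt; apply/orP; left; apply/eqP; ring.
  rewrite (ler_pM2l (ltr0Sn R 1)) ler_expR lerDl; apply: mulr_ge0; [lra | exact: ltW].
(* For s = 1 no power of r remains and 2^k exhausts the 7/10. For s >= 2, k <= N/2, and the
   exponents 35/100 + 20/101 + 1/101 stay below it. *)
case: (ltngtP s 1) s1 => // [s2|->] _; last first.
  rewrite /= expr1 expr0 !mulr1 divr1 mulrC; apply: ler_pM => //.
  - by rewrite ler_pdivrMr //; lra.
  - by apply: le_trans e3 _; rewrite ler_expR; lra.
have k2 : 2 * k%:R <= N%:R :> R.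
  apply: le_trans sk; rewrite mulrC ler_pM2l // ler_nat //.
have h1 : (2 / k%:R) ^+ s / s`!%:R * (100 * (k%:R * N%:R)) ^+ s.-1
    <= (200 * k%:R) ^+ s * expR (N%:R / k%:R) :> R.
  apply: (@le_trans _ _ ((2 / k%:R) ^+ s / s`!%:R * (100 * (k%:R * N%:R)) ^+ s)).
    rewrite ler_wpM2l ?divr_ge0 ?exprn_ge0 ?divr_ge0 // ler_weXn2l ?leq_pred //; nra.
  (* (2/k)(100 k N) = 200 N = 200 k (N/k), and (N/k)^s / s! is one term of the series of e^(N/k). *)
  have -> : (2 / k%:R) ^+ s / s`!%:R * (100 * (k%:R * N%:R)) ^+ s
     = (200 * k%:R) ^+ s * ((N%:R / k%:R) ^+ s / s`!%:R) :> R.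
    rewrite mulrAC -exprMn [RHS]mulrA -exprMn; congr (_ ^+ _ / _).
    by field; exact: lt0r_neq0.
  rewrite ler_wpM2l ?exprn_ge0 ?mulr_ge0 //.
  by apply: pow_fact_le_expR; rewrite divr_ge0.
have h2 : (200 * k%:R) ^+ s <= expR (20 / 101 * N%:R) :> R.
  apply: (@le_trans _ _ (expR (20 / 101 * k%:R * s%:R))).
    by apply: pow_le_expR; [rewrite mulr_ge0 | exact: le_expR_20_101].
  by rewrite ler_expR; lra.
have h3 : expR (N%:R / k%:R) <= expR (1 / 101 * N%:R) :> R.
  rewrite ler_expR ler_pdivrMr //; nra.
have h4 : 2 ^+ k <= expR (35 / 100 * N%:R) :> R.
  by apply: le_trans e3 _; rewrite ler_expR; lra.
apply: (@le_trans _ _ (expR (35 / 100 * N%:R) * (expR (20 / 101 * N%:R) * expR (1 / 101 * N%:R)))).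
  apply: ler_pM => //; apply: le_trans h1 _; apply: ler_pM => //; rewrite ?expR_ge0 //.
rewrite -!expRD -[leLHS]mul1r; apply: ler_pM; rewrite ?expR_ge0 //; first lra.
by rewrite ler_expR; lra.
Qed.

Lemma modc_residue_wave_summand k N n rho : (101 <= k <= N)%N -> k.-primitive_root rho ->
  (n%:R : R) <= 29 / 10 * N%:R ^+ 2 ->
  modc (residue0 (wave_summand N n rho)) <= 2 * expR (73 / 100 * N%:R).
Proof.
move=> kN prim hn; have /andP[k101 kleN] := kN.
have k0 : (0 < k)%N by apply: leq_trans k101.
have N0 : (0 < N)%N by apply: leq_trans kleN.
have D0 : 0 < 100 * (k%:R * N%:R) :> R by rewrite !mulr_gt0 // ltr0n.
pose r : R := (100 * (k%:R * N%:R))^-1.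
have r0 : 0 < r by rewrite invr_gt0.
have hr : 100 * (k%:R * (N%:R * r)) <= 1.
  by rewrite [k%:R * _]mulrA mulrA divff // lt0r_neq0.
have [B [b [hb hB]]] := lexp_wave_summand n k0 prim r0 hr.
rewrite (residue0_lexp r0 hb).
apply: le_trans (tail_exponent kN hn).
have s1 : (1 <= N %/ k)%N by rewrite divn_gt0.
have := wbound_coef (N %/ k).-1 (ltW r0) (proj1 hb).
have -> : b (N %/ k).-1 = shiftc b (N %/ k) by case: (N %/ k)%N s1.
rewrite -ler_pdivlMr ?exprn_gt0 // => h; apply: le_trans h _.
rewrite -exprVn invrK ler_wpM2r ?exprn_ge0 ?(ltW D0) //.
apply: le_trans hB _; rewrite ler_wpM2l ?expR_ge0 //.
rewrite ler_wpM2r ?divr_ge0 ?exprn_ge0 ?divr_ge0 // ler_wpM2l ?exprn_ge0 //.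
have gp : 0 < gapprod k rho N by apply: prodr_gt0 => j _; exact: gapw_gt0.
by rewrite -[leLHS]mul1r ler_pdivrMr // gapprod_ge.
Qed.

End WaveSummand.

(** * Sum of all waves, tail against main term, conclusion *)

Section Assembly.
Variable R : realType.
Local Notation C := (R[i]).
Implicit Types (rho : C).

Lemma wave_summandE N n rho : rho != 0 ->
  wave_summand N n rho = fun z => (rho * cexp z) ^+ (n + cycdeg N) / cyc N (rho * cexp z).
Proof.
move=> rho0; apply/funext => z; rewrite /wave_summand.
have x0 : rho * cexp z != 0 by rewrite mulf_neq0 // cexp_neq0.
rewrite -pmulrn -exprnP cexp_natM -exprMn exprD -mulrA; congr (_ * _).
have -> : \prod_(1 <= j < N.+1) (1 - rho ^- j * cexp (- (j%:R * z)))
    = cyc N (rho * cexp z) / (rho * cexp z) ^+ cycdeg N.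
  rewrite /cyc /cycdeg -prodrXr -prodf_div; apply: eq_bigr => j _.
  rewrite cexpN cexp_natM -invfM -exprMn mulrBl divff ?expf_neq0 //.
  by rewrite mul1r.
by rewrite invfM invrK mulrC.
Qed.

(** Additivity of the residue needs a finite list of meromorphic summands; one list [S] for all k
    later lets the sums over k and rho be exchanged. *)
Lemma sylvester_wave_seq k N n (S : seq C) : (0 < n)%N -> 0 \notin S -> uniq S ->
  (forall rho, k.-primitive_root rho -> rho \in S) ->
  sylvester_wave R k N n%:Z =
    \sum_(rho <- S | k.-primitive_root rho) residue0 (wave_summand N n rho).
Proof.
move=> n0 S0 uS hS; rewrite /sylvester_wave -big_filter.
set T := [seq rho <- S | _].
have [_ <-] : mero (fun z => \sum_(rho <- T) wave_summand N n rho z) /\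
    residue0 (fun z => \sum_(rho <- T) wave_summand N n rho z)
      = \sum_(rho <- T) residue0 (wave_summand N n rho).
  apply: residue0_sum => rho; rewrite mem_filter => /andP[_ rS].
  have rho0 : rho != 0 by apply: contraNneq S0 => <-.
  rewrite wave_summandE //; case: n n0 => // n _.
  by have [m _] := mero_cyc N (n + cycdeg N) rho0.
congr residue0; apply/funext => z.
have -> : [set rho : C | k.-primitive_root rho]%classic = [set` T]%classic.
  apply/seteqP; split=> rho /=; rewrite mem_filter; last by case/andP.
  by move=> h; apply/andP; split; [exact: h | exact: hS].
have uT : uniq T by exact: filter_uniq.
by rewrite [RHS]fsbig_seq.
Qed.

Lemma roots_upto N : exists S : seq C, [/\ 0 \notin S, uniq S,
  forall q j, (0 < j <= N)%N -> q ^+ j = 1 -> q \in S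
  & forall q, q \in S -> exists2 j, (0 < j <= N)%N & q ^+ j = 1].
Proof.
have [l [_ pl rl]] := cyc_roots R N; exists (undup l); split.
- rewrite mem_undup; apply/negP => /rl [j /andP[j0 _] /eqP].
  by rewrite expr0n eqn0Ngt j0 /= eq_sym oner_eq0.
- exact: undup_uniq.
- move=> q j /andP[j0 jN] qj; rewrite mem_undup.
  have : cyc N q = 0.
    by rewrite /cyc (bigD1_seq j) ?iota_uniq ?mem_index_iota ?j0 //= qj subrr mul0r.
  rewrite -pl => /eqP; rewrite prodf_seq_eq0 => /hasP [q' q'l].
  by rewrite /= subr_eq0 => /eqP ->.
by move=> q; rewrite mem_undup; exact: rl.
Qed.

Lemma sum_sylvester_waves N n : (0 < n)%N ->
  \sum_(1 <= k < N.+1) sylvester_wave R k N n%:Z = (npartitions N n)%:R.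
Proof.
move=> n0; have [S [S0 uS hS hS']] := roots_upto N.
have -> : \sum_(1 <= k < N.+1) sylvester_wave R k N n%:Z
   = \sum_(1 <= k < N.+1) \sum_(rho <- S | k.-primitive_root rho) residue0 (wave_summand N n rho).
  apply: eq_big_nat => k kN; apply: sylvester_wave_seq => // rho prim.
  exact: hS kN (prim_expr_order prim).
(* Each rho in S has exactly one order k, and k <= N, so the inner sum over k collapses to one
   term. *)
rewrite (exchange_big_dep xpredT) //=.
case: n n0 => // n _.
rewrite -(cycsum_partition (M := N) S0 uS hS npartitions_0S npartitions0 npartitionsS) //.
apply: eq_big_seq => rho rS.
have rho0 : rho != 0 by apply: contraNneq S0 => <-.
have [j /andP[j0 jN] rj] := hS' rho rS.
have [k prim kj] := prim_order_exists j0 rj.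
have k0 := prim_order_gt0 prim.
rewrite big_mkcond (bigD1_seq k) ?iota_uniq //=; last first.
  by rewrite mem_index_iota k0 ltnS; exact: leq_trans (dvdn_leq j0 kj) jN.
rewrite prim big1 ?addr0 ?wave_summandE // => i ik.
case: ifP => // prim'; case/eqP: ik; apply/eqP; rewrite eqn_dvd.
by rewrite (prim_order_dvd prim) (prim_order_dvd prim') !prim_expr_order ?eqxx.
Qed.

Lemma tail_waves_bound N n : (0 < n)%N -> (n%:R : R) <= 29 / 10 * N%:R ^+ 2 ->
  modc (\sum_(101 <= k < N.+1) sylvester_wave R k N n%:Z)
    <= N%:R * (N%:R * (2 * expR (73 / 100 * N%:R))).
Proof.
move=> n0 hn; have [S [S0 uS hS hS']] := roots_upto N.
set E := 2 * _; have E0 : 0 <= E by rewrite mulr_ge0 ?expR_ge0.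
apply: le_trans (modc_sum _ _ _) _.
apply: (@le_trans _ _ (\sum_(101 <= k < N.+1) (N%:R * E))); last first.
  rewrite sumr_const_nat -[X in X <= _]mulr_natl ler_wpM2r ?mulr_ge0 //.
  by rewrite ler_nat; lia.
rewrite big_nat_cond [leRHS]big_nat_cond; apply: ler_sum => k /andP[/andP[k101 kN] _].
have k0 : (0 < k)%N by apply: leq_trans k101.
rewrite (@sylvester_wave_seq k N n S) //; last first.
  by move=> rho prim; apply: hS (prim_expr_order prim); rewrite k0.
apply: le_trans (modc_sum _ _ _) _; rewrite -big_filter.
set T := [seq rho <- S | _].
apply: (@le_trans _ _ (\sum_(rho <- T) E)).
  rewrite big_seq [leRHS]big_seq; apply: ler_sum => rho; rewrite mem_filter => /andP[prim _].
  by apply: modc_residue_wave_summand prim hn; rewrite k101.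
rewrite big_const_seq count_predT iter_addr_0 -[X in X <= _]mulr_natl ler_wpM2r //.
rewrite ler_nat; apply: (@leq_trans k); last by [].
(* At most k primitive k-th roots, as all are roots of X^k - 1; together with at most N values of k
   this gives the factor N^2. *)
apply: max_unity_roots => //; last exact: filter_uniq.
by apply/allP => rho; rewrite mem_filter => /andP[prim _]; apply/unity_rootP;
  exact: prim_expr_order prim.
Qed.

(** Half of Stirling's formula with a polynomial loss. The step needs e (m+1)^(m+2) <= (m+2)^(m+2),
    which is 1 - 1/(m+2) <= e^(-1/(m+2)) raised to the power m + 2. *)
Lemma fact_expR_le m : (m.+1`!%:R : R) * expR m%:R <= m.+1%:R ^+ m.+2.
Proof.
elim: m => [|m IH]; first by rewrite expR0 expr1n mulr1.
rewrite factS natrM -(natr1 m) expRD mulrACA -mulrA [_ * (_ * expR 1)]mulrCA.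
have h : expR 1 * m.+1%:R ^+ m.+2 <= m.+2%:R ^+ m.+2 :> R.
  have m2 : 0 < m.+2%:R :> R by [].
  have : m.+1%:R / m.+2%:R <= expR (- m.+2%:R^-1) :> R.
    have -> : m.+1%:R = m.+2%:R - 1 :> R by rewrite -[m.+2%:R]natr1 addrK.
    by apply: le_trans (expR_ge1Dx _); rewrite mulrBl divff ?pnatr_eq0 // mul1r.
  move=> /(pow_le_expR m.+2 (divr_ge0 (ler0n _ _) (ler0n _ _))).
  rewrite mulNr mulVf ?pnatr_eq0 // expRN exprMn exprVn ler_pdivrMr ?exprn_gt0 //.
  by rewrite ler_pdivlMl ?expR_gt0.
rewrite [X in _ <= X]exprS ler_pM2l ?ltr0n //.
apply: le_trans h; rewrite mulrA mulrC ler_pM2l ?expR_gt0 //.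
Qed.

(** In n^m/(m! (m+1)!) the powers of m + 1 cancel up to (m+2) + (m+1) - 2m = 3. What remains is
    ((4/5) e^2)^m, and e^(1/4) >= 5/4 turns it into e^(7m/4). *)
Lemma npartitions_lower m N n : (m.+1 <= N)%N ->
  4 / 5 * m.+1%:R ^+ 2 <= n%:R :> R ->
  expR (7 / 4 * m%:R) <= (npartitions N n)%:R * m.+1%:R ^+ 3 :> R.
Proof.
move=> mN hn; set P : R := (npartitions N n)%:R.
set M : R := m.+1%:R; have M0 : 0 < M by rewrite ltr0n.
have e0 := expR_gt0 (m%:R : R).
have h1 : n%:R ^+ m <= P * (m.+1`!%:R * m`!%:R).
  rewrite -natrX -!natrM ler_nat; apply: leq_trans (npartitions_ge m n) _.
  by rewrite leq_mul // npartitions_leN.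
have h2 : (m.+1`!%:R : R) * expR m%:R <= M ^+ m.+2 := fact_expR_le m.
have h3 : (m`!%:R : R) * expR m%:R <= M ^+ m.+1.
  rewrite -(ler_pM2l M0) -exprS mulrA; apply: le_trans h2.
  by rewrite factS natrM.
have h4 : (4 / 5 * M ^+ 2) ^+ m <= n%:R ^+ m.
  by rewrite lerXn2r // nnegrE // mulr_ge0 ?exprn_ge0 ?ltW //; lra.
have h5 : expR (7 / 4 * m%:R) <= (4 / 5) ^+ m * (expR m%:R * expR m%:R) :> R.
  have -> : expR m%:R * expR m%:R = expR 2 ^+ m :> R.
    by rewrite -expRD -expRM_natr; congr expR; ring.
  rewrite -exprMn expRM_natr; apply: lerXn2r.
  - by rewrite nnegrE expR_ge0.
  - by rewrite nnegrE mulr_ge0 ?expR_ge0 // divr_ge0.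
  have -> : (2 : R) = 7 / 4 + 1 / 4 by lra.
  rewrite expRD mulrCA -[leLHS]mulr1 ler_pM2l ?expR_gt0 //.
  have := expR_ge1Dx (1 / 4 : R); lra.
have P0 : 0 <= P by rewrite ler0n.
have h6 : P * (m.+1`!%:R * m`!%:R) * (expR m%:R * expR m%:R) <= P * (M ^+ m.+2 * M ^+ m.+1).
  by rewrite -mulrA ler_wpM2l // mulrACA ler_pM // mulr_ge0 ?ler0n ?ltW.
have Mm : 0 < M ^+ (2 * m) by rewrite exprn_gt0.
rewrite -(ler_pM2r Mm).
have -> : P * M ^+ 3 * M ^+ (2 * m) = P * (M ^+ m.+2 * M ^+ m.+1).
  by rewrite -mulrA -!exprD; congr (_ * _ ^+ _); lia.
apply: le_trans h6.
apply: (@le_trans _ _ ((4 / 5 * M ^+ 2) ^+ m * (expR m%:R * expR m%:R))).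
  by rewrite exprMn -exprM [leRHS]mulrAC ler_pM2r.
by rewrite ler_wpM2r ?mulr_ge0 ?(ltW e0) // (le_trans h4).
Qed.

Lemma expR_dominates_pow5 (A c : R) : 0 <= A -> 0 < c ->
  exists N0, forall N, (N0 <= N)%N -> A * N%:R ^+ 5 <= expR (c * N%:R).
Proof.
move=> A0 c0; pose d := c ^+ 6 / 6`!%:R.
have d0 : 0 < d by rewrite divr_gt0 ?exprn_gt0 ?ltr0n ?fact_gt0.
exists (Num.truncn (A / d)).+1 => N hN.
have AdN : A <= d * N%:R.
  rewrite mulrC -ler_pdivrMr //; apply: ltW; apply: lt_le_trans (truncnS_gt _) _.
  by rewrite ler_nat.
have cN : 0 <= c * N%:R by rewrite mulr_ge0 // ltW.
apply: le_trans (pow_fact_le_expR 6 cN).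
have -> : (c * N%:R) ^+ 6 / 6`!%:R = d * N%:R * N%:R ^+ 5 by rewrite /d exprMn exprSr; ring.
by rewrite ler_wpM2r ?exprn_ge0.
Qed.

(** The factor 1/2 keeps the sum of the first hundred waves at least p_N(n)/2, so the error can be
    measured against that sum. *)
Lemma tail_negligible : exists N0, forall N n, (N0 <= N)%N ->
  (2 / 10 * N%:R ^+ 2 <= n%:R :> R) ->
  N%:R * (N%:R * (2 * expR (73 / 100 * N%:R)))
    <= 1 / 2 * expR (- (1 / 10 * N%:R)) * (npartitions N n)%:R :> R.
Proof.
(* N^5 combines N^2 from the tail with N^3 from [npartitions_lower]; 4 is 2 over 1/2, and e^3 pays
   for rounding N/2. *)
have [N1 hN1] := @expR_dominates_pow5 (4 * expR 3) (45 / 1000)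
   (mulr_ge0 (ler0n _ 4) (expR_ge0 _)) ltac:(lra).
exists (maxn 4 N1) => N n; rewrite geq_max => /andP[N4 NN1] hn.
have {}hN1 := hN1 N NN1.
pose m := (N./2).-1.
have mE : m.+1 = N./2 by rewrite /m prednK // half_gt0; lia.
have mN : (m.+1 <= N)%N by rewrite mE; lia.
have m2 : (2 * m.+1 <= N)%N by rewrite mE; lia.
have m3 : (N <= 2 * m + 3)%N by lia.
have NR : 0 < N%:R :> R by rewrite ltr0n; lia.
have m2R : 2 * m.+1%:R <= N%:R :> R by rewrite -natrM ler_nat.
have m3R : N%:R <= 2 * m%:R + 3 :> R by rewrite -natrM -natrD ler_nat.
have m0 : 0 <= m.+1%:R :> R by rewrite ler0n.
have hm : 4 / 5 * m.+1%:R ^+ 2 <= n%:R :> R.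
  apply: le_trans hn; nra.
have := npartitions_lower mN hm; set P := (npartitions N n)%:R => hP.
have P0 : 0 <= P by rewrite ler0n.
(* m >= (N - 3)/2, and (7/4)(3/2) < 3. *)
have hP' : expR (7 / 8 * N%:R - 3) <= P * N%:R ^+ 3.
  apply: (@le_trans _ _ (expR (7 / 4 * m%:R))); first by rewrite ler_expR; lra.
  apply: le_trans hP _; rewrite ler_wpM2l //; apply: lerXn2r.
  - by rewrite nnegrE.
  - by rewrite nnegrE ltW.
  - by rewrite ler_nat.
have N3 : 0 < N%:R ^+ 3 :> R by rewrite exprn_gt0.
rewrite -(ler_pM2r N3) -[X in _ <= X]mulrA.
apply: le_trans (ler_wpM2l _ hP'); last by rewrite mulr_ge0 ?expR_ge0 //; lra.
have -> : 7 / 8 * N%:R - 3 = 73 / 100 * N%:R + 1 / 10 * N%:R + 45 / 1000 * N%:R - 3 :> R by field.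
rewrite !expRD !expRN.
have a0 := expR_gt0 (73 / 100 * N%:R : R); have b0 := expR_gt0 (1 / 10 * N%:R : R).
have c0 := expR_gt0 (3 : R).
move: a0 b0 c0 hN1; set a := expR (73 / 100 * _); set b := expR (1 / 10 * _); set c := expR 3.
set d := expR (45 / 1000 * _) => a0 b0 c0 hN1.
have -> : 1 / 2 * b^-1 * (a * b * d * c^-1) = 1 / 2 * a * d / c by field; rewrite !lt0r_neq0.
rewrite ler_pdivlMr //.
have -> : N%:R * (N%:R * (2 * a)) * N%:R ^+ 3 * c = 1 / 2 * a * (4 * c * N%:R ^+ 5) by field.
by rewrite ler_pM2l // mulr_gt0.
Qed.

End Assembly.

Theorem theorem1p4 (R : realType) :
  exists (K : R) (N0 : nat),
  forall (lambda : R) (N n : nat),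
    2 / 10 <= lambda <= 29 / 10 ->
    (0 < N)%N -> (0 < n)%N -> n%:R = lambda * N%:R ^+ 2 ->
    (N0 <= N)%N ->
    exists2 eps : R[i],
      `|eps| <= (K * expR (- (1 / 10 * N%:R)))%:C &
      (npartitions N n)%:R =
        (\sum_(1 <= k < 101) sylvester_wave R k N n%:Z) * (1 + eps).
Proof.
have [N1 hN1] := tail_negligible R.
(* K = 1 works because the tail is at most E p_N(n)/2 and the main sum at least p_N(n)/2; N >= 101
   lets the sum over k <= N be split after k = 100. *)
exists 1, (maxn 101 N1) => lambda N n /andP[l1 l2] N0 n0 nE.
rewrite geq_max => /andP[N101 /hN1 {hN1}]/(_ n) tail.
have NN0 : 0 <= N%:R ^+ 2 :> R by rewrite exprn_ge0.
have nl : 2 / 10 * N%:R ^+ 2 <= n%:R :> R by rewrite nE ler_wpM2r.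
have nu : n%:R <= 29 / 10 * N%:R ^+ 2 :> R by rewrite nE ler_wpM2r.
have {}tail := le_trans (tail_waves_bound n0 nu) (tail nl).
have := sum_sylvester_waves R N n0.
rewrite (big_cat_nat (n := 101)) //=; last exact: leqW.
set S1 := \sum_(1 <= k < 101) _ in tail *; set S2 := \sum_(101 <= k < N.+1) _ in tail *.
set E := expR _ in tail *; set P := npartitions N n in tail * => sumE.
(* [npartitions_lower] at m = 0 gives p_N(n) >= 1. *)
have P0 : 0 < P%:R :> R.
  have n1 : 4 / 5 * 1%:R ^+ 2 <= n%:R :> R.
    by rewrite expr1n; apply: (@le_trans _ _ 1); [lra | rewrite ler1n].
  have := npartitions_lower N0 n1; rewrite expr1n mulr1; apply: lt_le_trans.
  exact: expR_gt0.
have E0 : 0 < E by exact: expR_gt0.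
have E1 : E <= 1 by rewrite /E expR_le1 oppr_le0 mulr_ge0 // divr_ge0.
have S1E : S1 = P%:R - S2 by rewrite -sumE addrK.
have S1ge : P%:R / 2 <= modc S1.
  have : modc (P%:R : R[i]) <= modc S1 + modc S2 by rewrite -sumE modcD.
  rewrite modc_nat; nra.
have S1n0 : S1 != 0 by rewrite -modc_gt0; apply: lt_le_trans S1ge; rewrite divr_gt0.
exists (S2 / S1); last by rewrite mulrDr mulr1 mulrCA divff // mulr1.
rewrite norm_modc lecR mul1r modcM modcV ler_pdivrMr ?modc_gt0 //.
apply: le_trans tail _.
have := ler_wpM2l (ltW E0) S1ge; apply: le_trans.
by rewrite le_eqVlt; apply/orP; left; apply/eqP; field.
Qed.
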